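(* Let $\Delta$ be a simplicial complex on the vertex set $[n]$. Then $\operatorname{depth}_E(K\{\Delta\})=r$ if and only if $\Delta^e=2^{[r]}\ast\Gamma$, where $\Gamma$ is a non-acyclic simplicial complex, $2^{[r]}$ is the $(r-1)$-simplex and $\dim\Gamma=\dim\Delta-r$.
   Context: $K$ is an infinite field and $E=K\langle e_1,\ldots,e_n\rangle$ is the exterior algebra. A simplicial complex $\Delta$ on $[n]=\{1,\dots,n\}$ is a collection of subsets of $[n]$ closed under taking subsets; it is always assumed that $\{i\}\in\Delta$ for all $i\in[n]$. For $F=\{i_1<\dots<i_k\}$ put $e_F=e_{i_1}\wedge\dots\wedge e_{i_k}$. The exterior face ring is $K\{\Delta\}=E/J_\Delta$ with $J_\Delta=(e_F:F\subseteq[n],F\notin\Delta)$. For a finitely generated graded left and right $E$-module $M$ with $am=(-1)^{\deg a\deg m}ma$ for homogeneous $a\in E$, $m\in M$, a linear form $v\in E_1$ is $M$-regular if $0:_Mv=vM$. A sequence $v_1,\dots,v_s$ in $E_1$ is $M$-regular if $v_i$ is regular on $M/(v_1,\dots,v_{i-1})M$ for $1\le i\le s$ and $M/(v_1,\dots,v_s)M\ne0$. The exterior depth $\operatorname{depth}_E(M)$ is the length of a maximal $M$-regular sequence. Exterior algebraic shifting: let $K'/K$ be a field extension containing elements $a_{ij}$, $1\le i,j\le n$, algebraically independent over $K$, let $f_i=\sum_{j=1}^na_{ij}e_j\in K'\otimes_KE$, and for $A=\{i_1<\dots<i_k\}$ let $f_A=f_{i_1}\wedge\dots\wedge f_{i_k}$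 with image $\bar f_A$ in $K'\{\Delta\}$. For sets of equal size let $A<_{\mathrm{lex}}B$ iff $\min((A\setminus B)\cup(B\setminus A))\in A$. The exterior shifting of $\Delta$ is the simplicial complex $$\Delta^e=\bigcup_{i=0}^{\dim\Delta+1}\Big\{A\subseteq[n]:|A|=i,\ \bar f_A\notin\operatorname{span}_{K'}\{\bar f_{A'}:|A'|=i,\ A'<_{\mathrm{lex}}A\}\Big\}.$$ $2^{[r]}$ is the complex of all subsets of $[r]=\{1,\dots,r\}$, and $\ast$ is the join, consisting of all unions $F\cup G$ of a face $F$ of the first and a face $G$ of the second complex, for complexes on disjoint vertex sets. A simplicial complex $\Gamma$ is called non-acyclic if there exists $0\le i\le\dim\Gamma$ with $\widetilde H_i(\Gamma;K)\ne0$, where $\widetilde H$ denotes reduced simplicial homology.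
   Formalization: Non-acyclic is taken with degrees −1 ≤ i ≤ dim Γ instead of 0 ≤ i ≤ dim Γ, so that Γ = {∅} counts as non-acyclic; otherwise the claim fails for Δ = 2^[n], where the depth is n and Γ = {∅}. *)

(* Defs.v *)
From HB Require Import structures.
From mathcomp Require Import boolp classical_sets cardinality.
From mathcomp Require Import all_boot all_order all_algebra.
From mathcomp Require Import ring_quotient.
From mathcomp Require Import mpoly ring.

Set Implicit Arguments.
Unset Strict Implicit.
Unset Printing Implicit Defensive.

Import Order.TTheory GRing.Theory Num.Theory.
Local Open Scope ring_scope.

(* x : extalg K n is the element \sum_F x F *: e_F. *)
Definition extalg (K : fieldType) (n : nat) := {ffun {set 'I_n} -> K^o}.

Section ExteriorAlgebra.
Variables (K : fieldType) (n : nat).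
Local Notation E := (extalg K n).
Implicit Types (x y z : E) (F G H : {set 'I_n}).

HB.instance Definition _ := GRing.Lmodule.on E.
HB.instance Definition _ := Vector.on E.

(* The number of transpositions needed to sort e_F /\ e_G. *)
Definition inversions F G : nat :=
  #|[set p : 'I_n * 'I_n | [&& p.1 \in F, p.2 \in G & (p.2 < p.1)%N]]%SET|.

(* e_F /\ e_G = (-1)^(inversions F G) e_(F :|: G) if F and G are disjoint, and 0
   otherwise. *)
Definition ext_mul x y : E :=
  [ffun H : {set 'I_n} => \sum_(F : {set 'I_n} | F \subset H)
     (-1) ^+ inversions F (H :\: F) * (x F * y (H :\: F))].

Definition ext_one : E := [ffun F : {set 'I_n} => (F == set0)%:R].

Lemma inversionsE F G :
  inversions F G = (\sum_(i in F) \sum_(j in G) (j < i))%N.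
Proof.
rewrite /inversions -sum1_card pair_big /= [RHS]big_mkcond [LHS]big_mkcond /=.
apply: eq_bigr => -[i j] _; rewrite inE /=.
by case: (i \in F); case: (j \in G); case: ltnP.
Qed.

Lemma inversions0l G : inversions set0 G = 0%N.
Proof. by rewrite inversionsE big_set0. Qed.

Lemma inversions0r F : inversions F set0 = 0%N.
Proof. by rewrite inversionsE big1 // => i _; apply: big_set0. Qed.

Lemma inversionsUl F G H : [disjoint F & G] ->
  inversions (F :|: G) H = (inversions F H + inversions G H)%N.
Proof. move=> dFG; rewrite !inversionsE -bigU //=.
by apply: eq_bigl => i; rewrite !inE. Qed.

Lemma inversionsUr F G H : [disjoint G & H] ->
  inversions F (G :|: H) = (inversions F G + inversions F H)%N.
Proof.
move=> dGH; rewrite !inversionsE -big_split /=; apply: eq_bigr => i _.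
by rewrite -bigU //=; apply: eq_bigl => j; rewrite !inE.
Qed.

Lemma ext_mulA : associative ext_mul.
Proof.
move=> x y z; apply/ffunP => H; rewrite !ffunE.
under eq_bigr => G _ do rewrite ffunE !mulr_sumr.
under [RHS]eq_bigr => F _ do rewrite ffunE mulr_suml mulr_sumr.
rewrite [RHS](exchange_big_dep (fun G => G \subset H)) /=; last first.
  by move=> F G sFH sGF; apply: subset_trans sGF sFH.
apply: eq_bigr => G sGH.
rewrite [RHS](reindex_onto (fun L => G :|: L) (fun F => F :\: G)) /=; last first.
  by move=> F /andP[_ sGF]; rewrite -{2}(setID F G) (setIidPr sGF).
have dE (L : {set 'I_n}) :
    L \subset H :\: G = (L \subset H) && ((G :|: L) :\: G == L).
  rewrite subsetD setDUl setDv set0U; congr (_ && _).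
  by apply/idP/eqP => [/setDidPl | ?]; [|exact/setDidPl].
apply: eq_big => [L | L sL].
  by rewrite subUset sGH subsetUl dE andbT.
have /andP[sLH /eqP dGL] : (L \subset H) && ((G :|: L) :\: G == L).
  by rewrite -dE.
have djGL : [disjoint G & L].
  by move: sL; rewrite subsetD disjoint_sym => /andP[].
have dL : [disjoint L & (H :\: (G :|: L))].
  rewrite -setI_eq0; apply/eqP/setP => i; rewrite !inE.
  by case: (i \in L); rewrite ?orbT ?andbF.
have HE : H :\: G = L :|: (H :\: (G :|: L)).
  apply/setP => i; rewrite !inE; have := subsetP sL i; rewrite !inE.
  by case: (i \in L); case: (i \in G); case: (i \in H) => //= ->.
rewrite dGL setDDl HE inversionsUr // inversionsUl // !exprD.
have mulE (a b c u v w : K) :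
  a * b * (u * (c * (v * w))) = b * c * (a * (u * v) * w) by ring.
exact: mulE.
Qed.

Lemma ext_mul1l : left_id ext_one ext_mul.
Proof.
move=> x; apply/ffunP => H; rewrite ffunE (bigD1 set0) ?sub0set //= big1.
  by rewrite ffunE eqxx inversions0l setD0 addr0 !mul1r.
by move=> F /andP[_ /negPf F0]; rewrite ffunE F0 mul0r mulr0.
Qed.

Lemma ext_mul1r : right_id ext_one ext_mul.
Proof.
move=> x; apply/ffunP => H; rewrite ffunE (bigD1 H) //= big1.
  by rewrite ffunE setDv eqxx inversions0r addr0 mul1r mulr1.
move=> F /andP[sFH neqFH]; rewrite ffunE setD_eq0 [H \subset F]negbTE ?mulr0 //.
by apply: contra neqFH => sHF; rewrite eqEsubset sFH.
Qed.

Lemma ext_mulDl : left_distributive ext_mul +%R.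
Proof.
move=> x y z; apply/ffunP => H; rewrite !ffunE -big_split /=.
by apply: eq_bigr => F _; rewrite ffunE mulrDl mulrDr.
Qed.

Lemma ext_mulDr : right_distributive ext_mul +%R.
Proof.
move=> x y z; apply/ffunP => H; rewrite !ffunE -big_split /=.
by apply: eq_bigr => F _; rewrite ffunE !mulrDr.
Qed.

Lemma ext_one_neq0 : ext_one != 0.
Proof.
apply/eqP => /ffunP/(_ set0); rewrite !ffunE eqxx => /eqP.
by rewrite (negPf (oner_neq0 K)).
Qed.

HB.instance Definition _ := GRing.Zmodule_isNzRing.Build E
  ext_mulA ext_mul1l ext_mul1r ext_mulDl ext_mulDr ext_one_neq0.

Lemma ext_scalerAl (a : K) x y : a *: (x * y) = (a *: x) * y.
Proof.
apply/ffunP => H; rewrite !ffunE scaler_sumr; apply: eq_bigr => F _.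
by rewrite ffunE /GRing.scale /= -mulrA mulrCA.
Qed.

Lemma ext_scalerAr (a : K) x y : a *: (x * y) = x * (a *: y).
Proof.
apply/ffunP => H; rewrite !ffunE scaler_sumr; apply: eq_bigr => F _.
rewrite ffunE /GRing.scale /= mulrCA; congr (_ * _); exact: mulrCA.
Qed.

HB.instance Definition _ := GRing.Lmodule_isLalgebra.Build K E ext_scalerAl.
HB.instance Definition _ := GRing.Lalgebra_isAlgebra.Build K E ext_scalerAr.

Definition ext_basis F : E := [ffun H : {set 'I_n} => (H == F)%:R].

Definition ext_gen (i : 'I_n) : E := ext_basis [set i].

(* enum F lists F in increasing order. *)
Definition wedge (f : 'I_n -> E) F : E := \prod_(i <- enum F) f i.

Definition homogeneous (d : nat) x : Prop := forall F, x F != 0 -> #|F| = d.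

Lemma ext_basisM F G :
  ext_basis F * ext_basis G =
  if [disjoint F & G] then (-1) ^+ inversions F G *: ext_basis (F :|: G) else 0.
Proof.
apply/ffunP => H; rewrite /GRing.mul /= ffunE.
have -> : \sum_(L : {set 'I_n} | L \subset H) (-1) ^+ inversions L (H :\: L) *
    (ext_basis F L * ext_basis G (H :\: L)) =
  ((F \subset H) && (H :\: F == G))%:R * (-1) ^+ inversions F G :> K.
  have [sFH /= | nsFH] := boolP (F \subset H); last first.
    rewrite mul0r big1 // => L sLH; rewrite ffunE.
    by case: eqP => [eLF | _]; [rewrite -eLF sLH in nsFH | rewrite mul0r mulr0].
  rewrite (bigD1 F) //= big1 ?addr0 => [|L /andP[_ /negPf nLF]]; last first.
    by rewrite ffunE nLF mul0r mulr0.
  rewrite !ffunE eqxx mul1r mulrC; case: eqP => [-> //|_].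
  by rewrite !mul0r.
case: ifPn => [dFG | ndFG]; rewrite !ffunE; last first.
  case: andP => [[_ /eqP eG]|]; rewrite ?mul0r //.
  case/negP: ndFG; rewrite -eG -setI_eq0; apply/eqP/setP => i.
  by rewrite !inE; case: (i \in F).
rewrite /GRing.scale /= mulrC; congr (_ * (nat_of_bool _)%:R).
apply/andP/eqP => [[sFH /eqP <-]|->]; first by rewrite -{1}(setIidPr sFH) setID.
rewrite subsetUl setDUl setDv set0U; split=> //; apply/eqP/setDidPl.
by rewrite disjoint_sym.
Qed.

Lemma wedge_gen F : wedge ext_gen F = ext_basis F.
Proof.
have sortF : sorted (fun i j : 'I_n => i < j)%N (enum F).
  rewrite /enum_mem; apply: sorted_filter => [j i k|]; first exact: ltn_trans.
  by have := iota_ltn_sorted 0 n; rewrite -val_enum_ord sorted_map enumT.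
rewrite /wedge -[in RHS](set_enum F).
elim: (enum F) sortF => [_|i s IHs] /=.
  by rewrite big_nil finset.set_nil; apply/ffunP => H; rewrite !ffunE.
rewrite path_sortedE => [/andP[/allP lt_is /IHs]|j k l]; last exact: ltn_trans.
rewrite big_cons => ->; rewrite ext_basisM finset.set_cons.
have -> : inversions [set i] [set:: s] = 0%N.
  rewrite inversionsE big_set1 big1 // => j; rewrite inE => /lt_is.
  by rewrite ltnNge leq_eqVlt negb_or => /andP[_ /negPf ->].
rewrite scale1r disjoints1 inE ifT //.
by apply/negP => /lt_is; rewrite ltnn.
Qed.

End ExteriorAlgebra.

Section QuotientModule.
Variable R : pzRingType.

Definition submodule (M : lmodType R) (N : set M) : Prop :=
  N 0 /\ forall (a : R) (x y : M), N x -> N y -> N (a *: x + y).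

Variables (S : set R) (M : lmodType R).

(* (S)M, where (S) is the two-sided ideal generated by S: the submodule of M
   generated by the products s *: m. *)
Definition ideal_mul : set M := fun x =>
  forall N : set M, submodule N -> (forall s m, S s -> N (s *: m)) -> N x.

Lemma ideal_mul_submodule : submodule ideal_mul.
Proof.
split=> [N [] // | a x y Sx Sy N subN SN]; apply: subN.2; first exact: Sx.
exact: Sy.
Qed.

Definition in_ideal_mul : pred M := fun x => `[< ideal_mul x >].

Lemma in_ideal_mulZ a x : x \in in_ideal_mul -> a *: x \in in_ideal_mul.
Proof.
have [N0 NP] := ideal_mul_submodule.
by move=> /asboolP Nx; apply/asboolP; rewrite -[_ *: _]addr0; apply: NP.
Qed.

Lemma in_ideal_mul_zmod_closed : zmod_closed in_ideal_mul.
Proof.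
have [N0 NP] := ideal_mul_submodule.
split=> [|x y /asboolP Nx /asboolP Ny]; apply/asboolP => //.
by rewrite addrC -scaleN1r; apply: NP.
Qed.

HB.instance Definition _ :=
  GRing.isZmodClosed.Build M in_ideal_mul in_ideal_mul_zmod_closed.

Local Notation N := (GRing.ZmodClosed.clone M in_ideal_mul _).

Definition quot_mod : Type := Quotient.quot N.

HB.instance Definition _ := GRing.Zmodule.on quot_mod.

Definition quot_proj (x : M) : quot_mod := (\pi_(Quotient.quot N) x)%qT.

Lemma quot_projP (q : quot_mod) : exists x, q = quot_proj x.
Proof. by exists (repr (q : Quotient.quot N)); rewrite /quot_proj reprK. Qed.

Lemma quot_proj_eq x y : quot_proj x = quot_proj y <-> ideal_mul (x - y).
Proof.
rewrite /quot_proj; split=> [/eqP | Nxy].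
  by rewrite -Quotient.idealrBE => /asboolP.
by apply/eqP; rewrite -Quotient.idealrBE; apply/asboolP.
Qed.

Lemma quot_projB : {morph quot_proj : x y / x - y}.
Proof. by move=> x y; rewrite /quot_proj raddfB. Qed.

Lemma quot_projD : {morph quot_proj : x y / x + y}.
Proof. by move=> x y; rewrite /quot_proj raddfD. Qed.

Definition quot_scale (a : R) (q : quot_mod) : quot_mod :=
  quot_proj (a *: repr (q : Quotient.quot N)).

Lemma quot_scaleE a x : quot_scale a (quot_proj x) = quot_proj (a *: x).
Proof.
apply/quot_proj_eq; rewrite -scalerBr; apply/asboolP; apply: in_ideal_mulZ.
by apply/asboolP; apply/quot_proj_eq; rewrite /quot_proj reprK.
Qed.

Lemma quot_scaleA a b q : quot_scale a (quot_scale b q) = quot_scale (a * b) q.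
Proof. by have [x ->] := quot_projP q; rewrite !quot_scaleE scalerA. Qed.

Lemma quot_scale1 : left_id 1 quot_scale.
Proof. by move=> q; have [x ->] := quot_projP q; rewrite quot_scaleE scale1r. Qed.

Lemma quot_scaleDr : right_distributive quot_scale +%R.
Proof.
move=> a p q; have [x ->] := quot_projP p; have [y ->] := quot_projP q.
by rewrite -quot_projD !quot_scaleE -quot_projD scalerDr.
Qed.

Lemma quot_scaleDl q : {morph quot_scale^~ q : a b / a + b}.
Proof.
move=> a b; have [x ->] := quot_projP q.
by rewrite !quot_scaleE scalerDl quot_projD.
Qed.

HB.instance Definition _ := GRing.Zmodule_isLmodule.Build R quot_mod
  quot_scaleA quot_scale1 quot_scaleDr quot_scaleDl.

Lemma quot_projZ a x : quot_proj (a *: x) = a *: quot_proj x.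
Proof. by rewrite -quot_scaleE. Qed.

End QuotientModule.

Section Depth.
Variables (K : fieldType) (n : nat).
Local Notation E := (extalg K n).

(* 0 :_M v = vM.  On a graded module with a m = (-1)^(deg a deg m) m a, the right
   action of a linear form has the same kernel and the same image as the left
   one, so only the left action is needed. *)
Definition regular_element (M : lmodType E) (v : E) : Prop :=
  forall m : M, v *: m = 0 <-> exists m' : M, m = v *: m'.

(* quot_mod (fun v => v \in vs) M is M / (vs)M. *)
Definition regular_sequence (M : lmodType E) (vs : seq E) : Prop :=
  [/\ forall v, v \in vs -> homogeneous 1 v,
      forall i, (i < size vs)%N ->
        regular_element (quot_mod (fun v => v \in take i vs) M) vs`_i
    & exists q : quot_mod (fun v => v \in vs) M, q <> 0].

Definition maximal_regular_sequence (M : lmodType E) (vs : seq E) : Prop :=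
  regular_sequence M vs /\ forall v, ~ regular_sequence M (rcons vs v).

(* r is the length of some maximal M-regular sequence; nothing is built in about
   all such sequences having the same length. *)
Definition has_depth (M : lmodType E) (r : nat) : Prop :=
  exists vs, maximal_regular_sequence M vs /\ size vs = r.

End Depth.

Section SimplicialComplexes.
Variable n : nat.
Implicit Types (F G A B : {set 'I_n}) (Delta Gamma : {set {set 'I_n}}).

(* A vertex i of [n] = {1, ..., n} is represented by i - 1 : 'I_n.  Not every
   i : 'I_n needs to be a vertex, so that complexes on subsets of [n] are
   covered. *)
Definition simplicial_complex Delta : Prop :=
  forall F G, F \in Delta -> G \subset F -> G \in Delta.

Definition complex_dim Delta : int := (\max_(F in Delta) #|F|)%:Z - 1.

(* [r] = {1, ..., r}, cut at n. *)
Definition initial_segment (r : nat) : {set 'I_n} :=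
  [set i : 'I_n | (i < r)%N]%SET.

Definition simplex (r : nat) : {set {set 'I_n}} := powerset (initial_segment r).

Definition simplicial_join Delta Gamma : {set {set 'I_n}} :=
  [set F :|: G | F in Delta, G in Gamma]%SET.

(* min ((A \ B) U (B \ A)) belongs to A. *)
Definition lex_lt A B : bool :=
  [exists i in A :\: B, forall j in (A :\: B) :|: (B :\: A), (i <= j)%N].

(* K{Delta} = E / J_Delta as an E-module, J_Delta being the two-sided ideal
   generated by the e_F with F not in Delta. *)
Definition nonface_monomials (K : fieldType) Delta : set (extalg K n) :=
  fun x => exists2 F, F \notin Delta & x = wedge (@ext_gen K n) F.
Arguments nonface_monomials : clear implicits.

Definition face_ring (K : fieldType) Delta : lmodType (extalg K n) :=
  quot_mod (nonface_monomials K Delta) (extalg K n)^o.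

Section ReducedHomology.
Variable K : fieldType.

(* c is the chain \sum_F c F *: F, where F stands for the oriented simplex
   [v_0, ..., v_d] with v_0 < ... < v_d. *)
Implicit Types c z w : {ffun {set 'I_n} -> K}.

Definition is_chain Gamma (d : int) c : Prop :=
  forall F, c F != 0 -> F \in Gamma /\ #|F|%:Z = d + 1.

(* The boundary of [v_0, ..., v_d] is \sum_k (-1)^k [v_0, ..., ^v_k, ..., v_d];
   here i is the omitted vertex v_k, so that k is the number of vertices of G
   smaller than i. *)
Definition boundary c : {ffun {set 'I_n} -> K} :=
  [ffun G : {set 'I_n} =>
     \sum_(i | i \notin G) (-1) ^+ #|[set j in G | (j < i)%N]%SET| * c (i |: G)].

(* Some cycle of degree d is not a boundary.  The empty face is a simplex of
   degree -1. *)
Definition reduced_homology_neq0 Gamma (d : int) : Prop :=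
  exists z, [/\ is_chain Gamma d z, boundary z = 0
    & ~ exists2 w, is_chain Gamma (d + 1) w & z = boundary w].

(* Degree -1 is included; it only matters for the complex {set0}, whose only
   nonzero reduced homology group is in degree -1.  That complex has to count
   as non-acyclic: it is the factor Gamma when Delta is the full simplex
   2^[n], whose face ring E has depth n. *)
Definition nonacyclic Gamma : Prop :=
  exists d : int, (-1 <= d <= complex_dim Gamma) /\ reduced_homology_neq0 Gamma d.

End ReducedHomology.

End SimplicialComplexes.

Arguments nonface_monomials {n} K Delta _.

Section AlgebraicShifting.
Variables (K K' : fieldType) (iota : {rmorphism K -> K'}) (n : nat).
Variable a : 'M[K']_n.
Implicit Types (A B : {set 'I_n}) (Delta : {set {set 'I_n}}).

(* mxvec lists the n * n entries of a. *)
Definition alg_independent : Prop :=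
  forall p : {mpoly K[n * n]}, mmap iota (fun k => mxvec a 0 k) p = 0 -> p = 0.

Definition generic_form (i : 'I_n) : extalg K' n :=
  \sum_j a i j *: ext_gen K' j.

Definition generic_monomial Delta A : face_ring K' Delta :=
  quot_proj (nonface_monomials K' Delta) (wedge generic_form A : (extalg K' n)^o).

(* The image of generic_monomial at A lies in the K'-span of the images at the
   B of the same size as A with B <lex A. *)
Definition in_smaller_span Delta A : Prop :=
  exists c : {set 'I_n} -> K',
    generic_monomial Delta A =
    \sum_(B : {set 'I_n} | (#|B| == #|A|) && lex_lt B A)
       (c B)%:A *: generic_monomial Delta B.

Definition ext_shift Delta : {set {set 'I_n}} :=
  \bigcup_(i < (\max_(F in Delta) #|F|).+1)
     [set A : {set 'I_n} | (#|A| == i) && `[< ~ in_smaller_span Delta A >]]%SET.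

End AlgebraicShifting.

(* Main.v *)
Require Import Defs.
From HB Require Import structures.
From mathcomp Require Import boolp classical_sets cardinality.
From mathcomp Require Import all_boot all_order all_algebra.
From mathcomp Require Import mpoly zify.

(** Put M = K{Delta}. Since v^2 = 0 for a linear form v, one has
    dim M/vM >= (dim M)/2, with equality if and only if v is M-regular; hence
    v_1, ..., v_s is M-regular if and only if dim M/(v_1, ..., v_s)M is
    (dim M)/2^s, its smallest possible value. These dimensions are ranks of
    matrices with polynomial entries in the coefficients of the v_i, so they are
    minimal for the generic forms f_1, ..., f_s, and also for suitable forms over
    the infinite field K.

    All maximal regular sequences have the same length by an exchange argument:
    if v and f_1, f_2 are M-regular, then some v, f_1 + c f_2 is. For
    f = f_1 + c f_2 acting on polynomials in c with coefficients in M, compare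
    two estimates of the dimension of the space of z of degree < k with
    f z in v M[c]: exactness of the action of f on M[c] bounds its growth with k
    from above, evaluation at k + 1 values of c bounds it from below.

    The f_A with A in Delta^e form a basis of M, and the sets meeting [r] form
    an initial segment of the lexicographic order. So dim M/(f_1, ..., f_r)M
    counts the members of Delta^e disjoint from [r], which form the complex
    Gamma_r, and f_1, ..., f_r is regular exactly when Delta^e = 2^[r] * Gamma_r.
    If f_1, ..., f_(r+1) is regular too, then Gamma_r is a cone, hence acyclic.
    If not, there is A in Gamma_r with r+1 not in A such that A + {r+1} is not
    in Gamma_r; as Delta^e is shifted, A is a facet of Gamma_r and the boundary
    of A + {r+1} is a cycle in Gamma_r, so Gamma_r is non-acyclic. *)

Set Implicit Arguments.
Unset Strict Implicit.
Unset Printing Implicit Defensive.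

Import Order.TTheory GRing.Theory Num.Theory.
Local Open Scope ring_scope.

(** * Square-zero operators on quotients *)

Section SquareZero.
Variables (K : fieldType) (m : nat).
Implicit Types A L : 'M[K]_m.

(** The x with x L in A form [kermx (L *m cokermx A)], so this is rank-nullity for the operator that
    L induces modulo A, whose image is (A + L)/A. *)
Lemma mxrank_kermx_coker A L : (A *m L <= A)%MS ->
  (\rank (kermx (L *m cokermx A)) + \rank (A + L)%MS = m + \rank A)%N.
Proof.
move=> AL; have := mxrank_mul_ker (A + L)%MS (cokermx A).
have -> : \rank ((A + L)%MS *m cokermx A) = \rank (L *m cokermx A).
  by rewrite addsmxMr mulmx_coker adds0mx.
have -> : \rank ((A + L) :&: kermx (cokermx A))%MS = \rank A.
  apply/eqmx_rank/andP; split.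
    by rewrite submxE; apply/eqP/sub_kermxP; exact: capmxSr.
  by rewrite sub_capmx addsmxSl; apply/sub_kermxP; exact: mulmx_coker.
rewrite mxrank_ker => <-.
have := rank_leq_col A; have := rank_leq_row (L *m cokermx A); lia.
Qed.

Lemma submx_ker_coker A L : (A *m L <= A)%MS -> L *m L = 0 ->
  (A + L <= kermx (L *m cokermx A))%MS.
Proof.
move=> AL LL; rewrite addsmx_sub; apply/andP; split; apply/sub_kermxP.
  by rewrite mulmxA; apply/eqP; rewrite -submxE.
by rewrite mulmxA LL mul0mx.
Qed.

(** On the quotient by A the image of L lies in its kernel, so it has at most half the dimension. *)
Lemma corank_square_zero_le A L : (A *m L <= A)%MS -> L *m L = 0 ->
  (m - \rank A <= 2 * (m - \rank (A + L)%MS))%N.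
Proof.
move=> AL LL; have := mxrank_kermx_coker AL.
have := mxrankS (submx_ker_coker AL LL).
have := rank_leq_col (A + L)%MS; have := rank_leq_col A; lia.
Qed.

(** Equality in the preceding bound forces kernel and image of the induced operator to have the same
    dimension, hence to coincide. *)
Lemma corank_square_zeroP A L : (A *m L <= A)%MS -> L *m L = 0 ->
  reflect (forall x : 'rV_m, (x *m L <= A)%MS -> (x <= A + L)%MS)
    (m - \rank A == 2 * (m - \rank (A + L)%MS))%N.
Proof.
move=> AL LL; have eqr := mxrank_kermx_coker AL.
have sub := submx_ker_coker AL LL.
have leA := rank_leq_col A; have leAL := rank_leq_col (A + L)%MS.
have kerE (x : 'rV_m) : (x *m L <= A)%MS = (x <= kermx (L *m cokermx A))%MS.
  by rewrite submxE -mulmxA; apply/eqP/sub_kermxP.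
apply: (iffP idP) => [/eqP eq2 x | H].
  rewrite kerE => /submx_trans; apply.
  by rewrite -(geq_leqif (mxrank_leqif_sup sub)); lia.
suff : (kermx (L *m cokermx A) <= A + L)%MS.
  by move/mxrankS; have := mxrankS sub; lia.
by apply/row_subP => i; apply: H; rewrite kerE row_sub.
Qed.

End SquareZero.

(** * The exchange property for pencils of operators *)

Section Pencil.
Variables (K : fieldType) (m : nat).

(* Polynomials of degree < k in c with coefficients in K^m are represented by
   their coefficients, as k x m matrices; [pencil f1 f2] is the multiplication
   by f1 + c f2. *)
Definition pad_mx k : 'M[K]_(k.+1, k) := \matrix_(i, j) (i == j :> nat)%:R.
Definition shift_mx k : 'M[K]_(k.+1, k) := \matrix_(i, j) (i == j.+1 :> nat)%:R.

Definition pencil (f1 f2 : 'M[K]_m) k (z : 'M[K]_(k, m)) : 'M[K]_(k.+1, m) :=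
  pad_mx k *m z *m f1 + shift_mx k *m z *m f2.

(** Left multiplication by this row evaluates at c the polynomial whose coefficients are the rows of
    a matrix. *)
Definition powers_mx k (c : K) : 'rV[K]_k := \row_i c ^+ i.

Fact pencil_is_linear f1 f2 k : linear (@pencil f1 f2 k).
Proof.
move=> c y z; rewrite /pencil !mulmxDr !mulmxDl -!scalemxAr -!scalemxAl.
by rewrite scalerDr addrACA.
Qed.
HB.instance Definition _ f1 f2 k :=
  GRing.isLinear.Build K 'M[K]_(k, m) 'M[K]_(k.+1, m) _ (@pencil f1 f2 k)
    (@pencil_is_linear f1 f2 k).

Lemma powers_pad k c : powers_mx k.+1 c *m pad_mx k = powers_mx k c.
Proof.
apply/rowP => j; rewrite !mxE (bigD1 (widen_ord (leqnSn k) j)) //= big1.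
  by rewrite !mxE eqxx mulr1 addr0.
move=> i ij; rewrite !mxE; case: eqP => [e|]; last by rewrite mulr0.
by case/eqP: ij; apply: val_inj.
Qed.

Lemma powers_shift k c : powers_mx k.+1 c *m shift_mx k = c *: powers_mx k c.
Proof.
apply/rowP => j; rewrite !mxE (bigD1 (lift ord0 j)) //= big1.
  by rewrite !mxE /= /bump /= add1n eqxx mulr1 addr0 exprS.
move=> i ij; rewrite !mxE; case: eqP => [e|]; last by rewrite mulr0.
by case/eqP: ij; apply: val_inj.
Qed.

Lemma powers_pencil f1 f2 k c (z : 'M_(k, m)) :
  powers_mx k.+1 c *m pencil f1 f2 z = powers_mx k c *m z *m (f1 + c *: f2).
Proof.
rewrite /pencil mulmxDr !mulmxA powers_pad powers_shift mulmxDr -!scalemxAl.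
by rewrite scalemxAr.
Qed.

Lemma pad_shift k : pad_mx k.+1 *m shift_mx k = shift_mx k.+1 *m pad_mx k.
Proof.
apply/matrixP => i j; rewrite !mxE.
rewrite (bigD1 (lift ord0 j)) //= [RHS](bigD1 (widen_ord (leqnSn k) j)) //=.
rewrite !big1 ?addr0 => [|l lj|l lj].
- by rewrite !mxE /= /bump /= !add1n !eqxx !mulr1.
- rewrite !mxE; case: (l =P j :> nat) => [e|]; last by rewrite mulr0.
  by case/eqP: lj; apply: val_inj.
- rewrite !mxE; case: (l =P j.+1 :> nat) => [e|]; last by rewrite mulr0.
  by case/eqP: lj; apply: val_inj; rewrite /= /bump /= add1n.
Qed.

Lemma pad_col k (a : 'rV_m) (b : 'M_(k, m)) :
  pad_mx k.+1 *m (col_mx a b : 'M_(1 + k, m)) =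
  (col_mx a (pad_mx k *m b) : 'M_(1 + k.+1, m)).
Proof.
have -> : pad_mx k.+1 = block_mx 1%:M 0 0 (pad_mx k) :> 'M_(1 + k.+1, 1 + k).
  apply/matrixP => i j; rewrite !mxE.
  case: splitP => i' ii; rewrite !mxE; case: splitP => j' jj; rewrite !mxE ii jj;
  by rewrite ?(ord1 i') ?(ord1 j') ?addn0 ?add1n.
by rewrite (@mul_block_col _ 1 k.+1 1 k m) mul1mx !mul0mx addr0 add0r.
Qed.

Lemma shift_col k (b : 'M_(k, m)) :
  shift_mx k *m b = (col_mx 0 b : 'M_(1 + k, m)).
Proof.
have -> : shift_mx k = col_mx 0 1%:M :> 'M_(1 + k, k).
  apply/matrixP => i j; rewrite !mxE.
  case: splitP => i' ii; rewrite !mxE ii ?(ord1 i') //.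
by rewrite (@mul_col_mx _ 1 k k m) mul0mx mul1mx.
Qed.

(** The product is expanded along z = a + c b; [pencil_exact] peels off constant terms in this
    way. *)
Lemma pencil_col f1 f2 k (a : 'rV_m) (b : 'M_(k, m)) :
  pencil f1 f2 (col_mx a b : 'M_(1 + k, m)) =
  (col_mx (a *m f1) (pencil f1 f2 b + (col_mx (a *m f2) 0 : 'M_(1 + k, m)))
     : 'M_(1 + k.+1, m)).
Proof.
rewrite /pencil pad_col shift_col.
rewrite (@mul_col_mx _ 1 k.+1 m m) (@mul_col_mx _ 1 k.+1 m m) mul0mx.
rewrite (@add_col_mx _ 1 k.+1 m) addr0; congr (@col_mx _ 1 k.+1 m _ _).
rewrite shift_col (@mul_col_mx _ 1 k m m) (@mul_col_mx _ 1 k m m) mul0mx -addrA.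
by rewrite (@add_col_mx _ 1 k m) add0r addr0.
Qed.

Lemma pencil_row f1 f2 (a : 'rV_m) :
  pencil f1 f2 a = (col_mx (a *m f1) (a *m f2) : 'M_(1 + 1, m)).
Proof.
rewrite /pencil shift_col.
have -> : pad_mx 1 *m a = (col_mx a 0 : 'M_(1 + 1, m)).
  have -> : pad_mx 1 = col_mx 1%:M 0 :> 'M_(1 + 1, 1).
    by apply/matrixP => i j; rewrite !mxE; case: splitP => i' ->; rewrite !mxE !ord1.
  by rewrite (@mul_col_mx _ 1 1 1 m) mul0mx mul1mx.
rewrite (@mul_col_mx _ 1 1 m m) (@mul_col_mx _ 1 1 m m) !mul0mx.
by rewrite (@add_col_mx _ 1 1 m) add0r addr0.
Qed.

Lemma pencil0 f1 f2 k : pencil f1 f2 (0 : 'M_(k, m)) = 0.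
Proof. exact: raddf0. Qed.

Section Exact.
Variables f1 f2 : 'M[K]_m.
Hypotheses (f11 : f1 *m f1 = 0) (f22 : f2 *m f2 = 0)
  (f12 : f1 *m f2 = - (f2 *m f1)).

Lemma pencilK k (z : 'M_(k, m)) : pencil f1 f2 (pencil f1 f2 z) = 0.
Proof.
rewrite /pencil !(mulmxDr, mulmxDl) -!mulmxA f11 f22 f12 !mulmx0 add0r addr0.
by rewrite !mulmxN !mulmxA pad_shift addrN.
Qed.

Hypothesis reg : (4 * (m - \rank (f1 + f2)%MS) = m)%N.

(** Dividing by f1 and then by f2 reduces the dimension by a factor of at most 2 each time; [reg]
    leaves no slack, so both steps are equalities. *)
Lemma regular_pair : (kermx f1 <= f1)%MS /\
  forall x : 'rV_m, (x *m f2 <= f1)%MS -> (x <= f1 + f2)%MS.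
Proof.
have f1f2 : (f1 *m f2 <= f1)%MS by rewrite f12 -mulNmx submxMl.
have f01 : ((0 : 'M_m) *m f1 <= (0 : 'M_m))%MS by rewrite mul0mx sub0mx.
have s1 := corank_square_zero_le f01 f11.
have s2 := corank_square_zero_le f1f2 f22.
rewrite mxrank0 adds0mx in s1.
split; last by apply/corank_square_zeroP => //; apply/eqP; lia.
have ker1 : (f1 <= kermx f1)%MS by apply/sub_kermxP.
rewrite -(geq_leqif (mxrank_leqif_sup ker1)) mxrank_ker; lia.
Qed.

(** The constant term a of z satisfies a f1 = 0, so a = y f1, and subtracting the pencil applied to
    y leaves c times a shorter polynomial that the pencil kills. The regularity of f2 modulo f1
    enters for two coefficients, where the induction starts. *)
Lemma pencil_exact k (z : 'M_(k.+2, m)) : pencil f1 f2 z = 0 ->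
  exists y : 'M_(k.+1, m), z = pencil f1 f2 y.
Proof.
have [ker1 ker2] := regular_pair.
have exact1 (x : 'rV_m) : x *m f1 = 0 -> exists y : 'rV_m, x = y *m f1.
  by move=> /sub_kermxP/submx_trans/(_ ker1)/submxP.
have step l (b : 'M_(l.+1, m)) (y : 'rV_m) :
    pencil f1 f2 b + (col_mx (y *m f1 *m f2) 0 : 'M_(1 + l.+1, m)) = 0 ->
  pencil f1 f2 (b - (col_mx (y *m f2) 0 : 'M_(1 + l, m))) = 0.
  rewrite raddfB /= pencil_col => /eqP; rewrite addr_eq0 => /eqP ->.
  rewrite pencil0 add0r -!mulmxA f22 f12 mulmx0 col_mx0.
  rewrite mulmxN -(@oppr0 'M[K]_(l.+1, m)) -(@opp_col_mx _ 1 l.+1 m) opprK oppr0.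
  exact: addrN.
elim: k z => [|k IHk] z.
  rewrite -[z](@vsubmxK _ 1 1 m); set a := usubmx _; set b := dsubmx _.
  rewrite pencil_col -[RHS](@col_mx0 _ 1 2 m) => /(@eq_col_mx _ 1 _ m)[/exact1[y ->] /step].
  set b' := b - _ => eb'.
  have b'E : b = y *m f2 + b'.
    rewrite /b' addrCA [X in _ + (_ - X)](_ : _ = y *m f2) ?addrN ?addr0 //.
    by apply/matrixP => i j; rewrite (mxE, ord1) mxE; case: splitP => // i' _; rewrite ord1.
  move: eb'; rewrite pencil_row -[RHS](@col_mx0 _ 1 1 m) => /(@eq_col_mx _ 1 _ m)[b1 b2].
  have [x xE] := exact1 _ b1.
  have /exact1[x' x'E] : x *m f2 *m f1 = 0.
    by rewrite -mulmxA -[f2 *m f1]opprK -f12 mulmxN mulmxA -xE b2 oppr0.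
  have /ker2/sub_addsmxP[[u1 u2] /= xu] : (x *m f2 <= f1)%MS.
    by rewrite x'E submxMl.
  (* Subtracting u2 f1 from y keeps the constant term, as f1 squares to 0, and adds - u2 f1 f2 = u2
     f2 f1 = b' to the coefficient of c. *)
  exists (y - u2 *m f1); rewrite pencil_row !mulmxBl -(mulmxA u2) f11 mulmx0 subr0.
  congr (@col_mx _ 1 1 m _ _); rewrite b'E xE xu.
  by rewrite mulmxDl -!mulmxA f11 f12 mulmx0 add0r mulmxN opprK.
rewrite -[z](@vsubmxK _ 1 k.+2 m); set a := usubmx _; set b := dsubmx _.
rewrite pencil_col -[RHS](@col_mx0 _ 1 k.+3 m) => /(@eq_col_mx _ 1 _ m)[/exact1[y ->] /step].
case/IHk => y' yE; exists (col_mx y y' : 'M_(1 + k.+1, m)).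
by rewrite pencil_col -yE subrK.
Qed.
Variable v : 'M[K]_m.
Hypotheses (vv : v *m v = 0) (v1 : v *m f1 = - (f1 *m v))
  (v2 : v *m f2 = - (f2 *m v)) (regv : (2 * (m - \rank v) = m)%N).

Let mulv k : 'Hom('M[K]_(k, m), 'M[K]_(k, m)) := linfun (mulmxr v).
Let pen k : 'Hom('M[K]_(k, m), 'M[K]_(k.+1, m)) := linfun (@pencil f1 f2 k).
(* Z k consists of the z with (f1 + c f2) z in v M[c]. *)
Let Z k := lker (linfun (mulmxr (cokermx v)) \o pen k)%VF.

Lemma kermx_regular : (kermx v <= v)%MS.
Proof.
have vk : (v <= kermx v)%MS by apply/sub_kermxP.
by rewrite -(geq_leqif (mxrank_leqif_sup vk)) mxrank_ker; lia.
Qed.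

Lemma mem_Z k z : reflect (exists u : 'M_(k.+1, m), pencil f1 f2 z = u *m v) (z \in Z k).
Proof.
rewrite memv_ker comp_lfunE !lfunE /=; apply: (iffP idP) => [|[u ->]].
  by rewrite -submxE => /submxP.
by rewrite -mulmxA mulmx_coker mulmx0.
Qed.

Lemma dim_ker_mulv k : (\dim (lker (mulv k)) <= \rank v * k)%N.
Proof.
have := limg_ker_dim (mulv k) fullv; rewrite capfv dimvf dim_matrix.
suff /dimvS : (lker (mulv k) <= limg (mulv k))%VS by lia.
apply/subvP => y; rewrite memv_ker lfunE /= => /eqP/sub_kermxP yv.
have /submxP[u ->] := submx_trans yv kermx_regular.
by apply/memv_imgP; exists u; rewrite ?memvf // lfunE.
Qed.

(** If the pencil sends z into v M[c], it kills z v. By exactness z v is the pencil applied to some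
    z' with one coefficient fewer, and z' lies in [Z] again. So z -> z v maps [Z k.+2] into the
    image of [Z k.+1], and its kernel is bounded by [dim_ker_mulv]. *)
Lemma dim_Z_step k :
  (\dim (Z k.+2) + \dim (lker (pen k.+1)) <= \dim (Z k.+1) + \rank v * k.+2)%N.
Proof.
pose X := (limg (pen k.+1) :&: limg (mulv k.+2))%VS.
have le1 : (\dim (mulv k.+2 @: Z k.+2) <= \dim X)%N.
  apply/dimvS/subvP => _ /memv_imgP[y /mem_Z[u yu] ->].
  rewrite memv_cap memv_img ?memvf // andbT lfunE /=.
  have /pencil_exact[z ->] : pencil f1 f2 (y *m v) = 0.
    suff -> : pencil f1 f2 (y *m v) = - (pencil f1 f2 y *m v).
      by rewrite yu -mulmxA vv mulmx0 oppr0.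
    by rewrite /pencil mulmxDl opprD -!mulmxA v1 v2 !mulmxN.
  by apply/memv_imgP; exists z; rewrite ?memvf // lfunE.
have le2 : (\dim X <= \dim (pen k.+1 @: Z k.+1))%N.
  apply/dimvS/subvP => x; rewrite memv_cap => /andP[/memv_imgP[z _ ->]].
  move=> /memv_imgP[u _]; rewrite !lfunE /= => zu.
  by apply/memv_imgP; exists z; rewrite ?lfunE //; apply/mem_Z; exists u.
have := limg_ker_dim (mulv k.+2) (Z k.+2).
have := limg_ker_dim (pen k.+1) (Z k.+1).
have -> : (Z k.+1 :&: lker (pen k.+1) = lker (pen k.+1))%VS.
  apply/capv_idPr/subvP => z; rewrite memv_ker lfunE /= => /eqP z0.
  by apply/mem_Z; exists 0; rewrite mul0mx.
have := dimvS (capvSr (Z k.+2) (lker (mulv k.+2))).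
have := dim_ker_mulv k.+2; lia.
Qed.

Lemma dim_ker_pencil k : (k * m <= \dim (lker (pen k)) + \dim (lker (pen k.+1)))%N.
Proof.
have := limg_ker_dim (pen k) fullv; rewrite capfv dimvf dim_matrix.
suff : (\dim (limg (pen k)) <= \dim (lker (pen k.+1)))%N by lia.
apply/dimvS/subvP => _ /memv_imgP[z _ ->].
by rewrite memv_ker !lfunE /= pencilK.
Qed.

(** The kernels of the pencils are controlled by [dim_ker_pencil] only for two consecutive degrees
    together, so the induction advances by 2. With p the rank of v and m = 2p, a double step adds
    p(2j+2) + p(2j+3) and loses at least (2j+1)m, a gain of at most 3p. *)
Lemma dim_Z_ub j : (\dim (Z (2 * j).+1) <= m + 3 * \rank v * j)%N.
Proof.
elim: j => [|j IHj].
  by have := dimvS (subvf (Z 1)); rewrite !muln0 dimvf dim_matrix; lia.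
rewrite (_ : 2 * j.+1 = (2 * j).+2)%N; last by lia.
have := dim_Z_step (2 * j); have := dim_Z_step (2 * j).+1.
have := dim_ker_pencil (2 * j).+1.
have mE : m = (2 * \rank v)%N by have := rank_leq_col v; lia.
rewrite (_ : (2 * j).+1 * m = (2 * j).+1 * (2 * \rank v))%N; last by rewrite -mE.
lia.
Qed.

(** The pencil applied to z has k + 1 coefficients, so it vanishes modulo v as soon as it does at k
    + 1 values of c. Each value imposes at most rho linear conditions on z. *)
Lemma dim_Z_lb k rho : (exists2 s : seq K, uniq s & size s = k.+1) ->
  (forall c, \rank ((f1 + c *: f2) *m cokermx v) <= rho)%N ->
  (k * m <= \dim (Z k) + k.+1 * rho)%N.
Proof.
move=> [s uniq_s size_s] le_rho; pose B c := (f1 + c *: f2) *m cokermx v.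
(* A rank factorization padded to exactly rho columns, so that all values of c share one target
   space. *)
have /boolp.choice[C CP] c : exists C : 'M_(m, rho), exists R, B c = C *m R.
  exists (col_base (B c) *m pid_mx (\rank (B c))).
  exists (pid_mx (\rank (B c)) *m row_base (B c)).
  rewrite mulmxA -(mulmxA (col_base _)) pid_mx_id ?le_rho // pid_mx_1 mulmx1.
  by rewrite mulmx_base.
pose Phi (z : 'M_(k, m)) := \matrix_(i < k.+1) (powers_mx k s`_i *m z *m C s`_i).
have Phi_lin : linear Phi.
  move=> b y z; apply/row_matrixP => i.
  by rewrite linearP /= !rowK mulmxDr mulmxDl -scalemxAr -scalemxAl.
pose Phil : {linear 'M_(k, m) -> 'M_(k.+1, rho)} := HB.pack Phi
  (GRing.isLinear.Build K 'M_(k, m) 'M_(k.+1, rho) _ Phi Phi_lin).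
have := limg_ker_dim (linfun Phil) fullv; rewrite capfv dimvf dim_matrix.
have := dimvS (subvf (limg (linfun Phil))); rewrite dimvf dim_matrix.
suff : (\dim (lker (linfun Phil)) <= \dim (Z k))%N by lia.
apply/dimvS/subvP => z; rewrite memv_ker lfunE /= => /eqP Phi0.
apply/mem_Z/submxP; rewrite submxE; set w := _ *m _.
(* The transpose of V evaluates the coefficients in w at the k + 1 distinct points, and it is
   invertible. *)
pose V := Vandermonde k.+1 (\row_(i < k.+1) s`_i).
have Vu : V^T \in unitmx.
  rewrite unitmx_tr unitmxE det_Vandermonde unitfE.
  apply/prodf_neq0 => i _; apply/prodf_neq0 => j ij; rewrite !mxE subr_eq0.
  by rewrite nth_uniq ?size_s ?ltn_ord // neq_ltn ij orbT.
suff Vw : V^T *m w = 0 by rewrite -[w](mulKmx Vu) Vw mulmx0.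
apply/row_matrixP => i; rewrite row0 row_mul.
have -> : row i V^T = powers_mx k.+1 s`_i by apply/rowP => j; rewrite !mxE.
rewrite /w mulmxA powers_pencil -(mulmxA (_ *m z)).
have [R] := CP s`_i; rewrite /B => ->.
rewrite mulmxA -[_ *m C _](rowK (fun i => powers_mx k s`_i *m z *m C s`_i)).
by rewrite -/(Phi z) Phi0 row0 mul0mx.
Qed.

(* Write m = 2p. The dimension of Z k is at most 3p/2 k up to a constant, whereas
   k m - (k + 1) rho bounds it from below if all f1 + c f2 have rank at most rho
   modulo v. So some rank is at least p/2, and then it equals p/2. *)
Lemma pencil_exchange : (forall k, exists2 s : seq K, uniq s & size s = k) ->
  exists c, (4 * (m - \rank (v + (f1 + c *: f2)%R)%MS) = m)%N.
Proof.
move=> infK; apply: contrapT => noc.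
have fc0 c : (f1 + c *: f2) *m (f1 + c *: f2) = 0.
  rewrite !(mulmxDr, mulmxDl) -!scalemxAr -!scalemxAl f11 f22 f12.
  by rewrite !scaler0 add0r addr0 scalerN addrN.
have vfc c : (v *m (f1 + c *: f2) <= v)%MS.
  rewrite mulmxDr -scalemxAr v1 v2 scalerN -opprD scalemxAl -mulmxDl -mulNmx.
  exact: submxMl.
(* Without a suitable c the inequality 4 rank <= m is strict, and both sides are multiples of 4 by
   [reg]. *)
have rankB c : (4 * \rank ((f1 + c *: f2) *m cokermx v) + 4 <= m)%N.
  have lt4 : (m < 4 * (m - \rank (v + (f1 + c *: f2)%R)%MS))%N.
    rewrite ltn_neqAle; apply/andP; split.
      by apply/eqP => e; apply: noc; exists c.
    by have := corank_square_zero_le (vfc c) (fc0 c); lia.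
  have := mxrank_kermx_coker (vfc c).
  have := rank_leq_col (v + (f1 + c *: f2)%R)%MS.
  rewrite mxrank_ker; have := rank_leq_row ((f1 + c *: f2) *m cokermx v); lia.
have [q mq] : exists q, m = (4 * q)%N by exists (m - \rank (f1 + f2)%MS)%N.
have rq : \rank v = (2 * q)%N by have := rank_leq_col v; lia.
have rho c : (\rank ((f1 + c *: f2) *m cokermx v) <= q.-1)%N.
  by have := rankB c; lia.
(* With m = 4q and k = 2m + 1, an odd number as [dim_Z_ub] requires, the bounds on the dimension d
   of [Z k] read 6qm + 2m + 2q + 2 <= d and d <= 6qm + m. *)
have := dim_Z_lb (infK (2 * m).+2) rho.
have := dim_Z_ub m; have := rankB 0; rewrite rq.
move: (\dim _) (\rank _) => d r; move: mq; clear; move: m => M ->.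
by case: q => [|q']; nia.
Qed.
End Exact.
End Pencil.

(* K^N / I is identified with K^m by the projection Q, which P splits. *)
Section QuotientOperators.
Variables (K : fieldType) (N m : nat) (I : 'M[K]_N).
Variables (Q : 'M[K]_(N, m)) (P : 'M[K]_(m, N)).
Hypothesis PQ : P *m Q = 1%:M.
Hypothesis QI : forall l (x : 'M_(l, N)), (x <= I)%MS = (x *m Q == 0).

(** When I is stable under g, this is the operator that g induces on K^N / I. *)
Definition quot_op (g : 'M[K]_N) : 'M[K]_m := P *m g *m Q.

Lemma quot_projection_full : row_full Q.
Proof. by apply/row_fullP; exists P. Qed.

Lemma quot_opE g : (I *m g <= I)%MS -> Q *m quot_op g = g *m Q.
Proof.
move=> Ig; apply/eqP; rewrite -subr_eq0 /quot_op !mulmxA -mulmxBl -QI.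
rewrite -{2}[g]mul1mx -mulmxBl.
apply: submx_trans Ig; apply: submxMr.
by rewrite QI mulmxBl mul1mx -mulmxA PQ mulmx1 subrr.
Qed.

Lemma quot_opM g h : (I *m h <= I)%MS -> quot_op g *m quot_op h = quot_op (g *m h).
Proof. by move=> Ih; rewrite {1}/quot_op -mulmxA quot_opE // /quot_op !mulmxA. Qed.

Lemma quot_opN g : quot_op (- g) = - quot_op g.
Proof. by rewrite /quot_op mulmxN mulNmx. Qed.

Lemma quot_op0 : quot_op 0 = 0.
Proof. by rewrite /quot_op mulmx0 mul0mx. Qed.

Lemma quot_opDZ g c h : quot_op (g + c *: h) = quot_op g + c *: quot_op h.
Proof. by rewrite /quot_op mulmxDr mulmxDl -scalemxAr -scalemxAl. Qed.

Lemma eqmx_quot_op g : (I *m g <= I)%MS -> (g *m Q :=: quot_op g)%MS.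
Proof. by move=> Ig; rewrite -quot_opE //; apply: eqmxMfull quot_projection_full. Qed.

Lemma mxrank_adds_quot l (X : 'M_(l, N)) :
  \rank (I + X)%MS = (\rank I + \rank (X *m Q))%N.
Proof.
rewrite -(mxrank_mul_ker _ Q) addnC; congr (_ + _)%N; last first.
  by rewrite addsmxMr; have /eqP -> : I *m Q == 0; rewrite -?QI ?adds0mx.
apply/eqmx_rank/andP; split.
  by rewrite QI; apply/eqP/sub_kermxP; exact: capmxSr.
by rewrite sub_capmx addsmxSl; apply/sub_kermxP/eqP; rewrite -QI.
Qed.

Lemma corank_quot : (N - \rank I = m)%N.
Proof.
have := mxrank_adds_quot 1%:M; rewrite mul1mx.
have -> : \rank (I + 1%:M)%MS = N.
  by apply/eqP; rewrite -[_ == _]/(row_full _) -sub1mx addsmxSr.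
by have /eqP -> := quot_projection_full; lia.
Qed.

Lemma corank_adds_quot l (X : 'M_(l, N)) :
  (N - \rank (I + X)%MS = m - \rank (X *m Q))%N.
Proof. by rewrite mxrank_adds_quot; have := corank_quot; lia. Qed.

Variables v f1 f2 : 'M[K]_N.
Hypothesis infK : forall k, exists2 s : seq K, uniq s & size s = k.
Hypotheses (Iv : (I *m v <= I)%MS) (I1 : (I *m f1 <= I)%MS)
  (I2 : (I *m f2 <= I)%MS).
Hypotheses (vv : v *m v = 0) (f11 : f1 *m f1 = 0) (f22 : f2 *m f2 = 0)
  (f12 : f1 *m f2 = - (f2 *m f1)) (v1 : v *m f1 = - (f1 *m v))
  (v2 : v *m f2 = - (f2 *m v)).

Lemma pencil_exchange_quot :
  (2 * (N - \rank (I + v)%MS) = N - \rank I)%N ->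
  (4 * (N - \rank (I + (f1 + f2))%MS) = N - \rank I)%N ->
  exists c, (4 * (N - \rank (I + (v + (f1 + c *: f2)%R))%MS) = N - \rank I)%N.
Proof.
rewrite !corank_adds_quot corank_quot.
rewrite (eqmx_quot_op Iv) addsmxMr (adds_eqmx (eqmx_quot_op I1) (eqmx_quot_op I2)).
move=> rv rf; have [] := pencil_exchange (f1 := quot_op f1) (f2 := quot_op f2)
  _ _ _ _ _ _ _ _ infK (v := quot_op v).
all: rewrite ?quot_opM // -?quot_opN ?(vv, f11, f22, f12, v1, v2) ?quot_op0 //.
move=> c <-; exists c; rewrite corank_adds_quot addsmxMr.
have Ic : (I *m (f1 + c *: f2)%R <= I)%MS.
  by rewrite mulmxDr -scalemxAr addmx_sub // scalemx_sub.
by rewrite -quot_opDZ (adds_eqmx (eqmx_quot_op Iv) (eqmx_quot_op Ic)).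
Qed.
End QuotientOperators.

Lemma quot_projection_exists (K : fieldType) N (I : 'M[K]_N) :
  exists m, exists Q : 'M[K]_(N, m), exists P : 'M[K]_(m, N),
  P *m Q = 1%:M /\ forall l (x : 'M_(l, N)), (x <= I)%MS = (x *m Q == 0).
Proof.
exists (\rank (cokermx I)), (col_base (cokermx I)), (pinvmx (col_base (cokermx I))).
split=> [|l x]; first exact/mulVpmx/col_base_full.
rewrite submxE -{1}(mulmx_base (cokermx I)) mulmxA.
by rewrite mulmx_free_eq0 // row_base_free.
Qed.

(** * Linear forms acting on the exterior algebra *)

Section SquareZeroSums.
Variable R : pzRingType.

(** Squares vanish by a separate hypothesis because anticommutation does not imply it in
    characteristic 2. *)
Lemma sum_sqr0 (I : Type) (r : seq I) (x : I -> R) :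
  (forall i, x i * x i = 0) -> (forall i j, x i * x j = - (x j * x i)) ->
  (\sum_(i <- r) x i) * (\sum_(i <- r) x i) = 0.
Proof.
move=> xx xC; elim: r => [|i r IHr]; first by rewrite big_nil mul0r.
rewrite big_cons mulrDl !mulrDr xx IHr add0r addr0 mulr_sumr mulr_suml.
by rewrite -big_split big1 //= => j _; rewrite xC addNr.
Qed.

End SquareZeroSums.

Section WedgeMatrices.
Variables (R : comPzRingType) (n : nat).
Local Notation N := #|{set 'I_n}|.

(* The matrix of the left multiplication by e_i in the basis of the e_F. *)
Definition wedge_mx (i : 'I_n) : 'M[R]_N :=
  \matrix_(p < N, q < N)
    let F := enum_val p : {set 'I_n} in
    if (i \notin F) && (enum_val q == i |: F)%SET
    then (-1) ^+ inversions [set i]%SET F else 0.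

Definition form_mx (u : 'rV[R]_n) : 'M[R]_N := \sum_i u 0 i *: wedge_mx i.

Definition nonface_mx (Delta : {set {set 'I_n}}) : 'M[R]_N :=
  \matrix_(p < N, q < N) ((p == q) && (enum_val p \notin Delta))%:R.

Fact form_mx_is_linear : linear form_mx.
Proof.
move=> c u w; rewrite /form_mx scaler_sumr -big_split; apply: eq_bigr => i _ /=.
by rewrite !mxE scalerDl scalerA.
Qed.
HB.instance Definition _ := GRing.isLinear.Build R 'rV[R]_n 'M[R]_N _ form_mx
  form_mx_is_linear.

End WedgeMatrices.

Lemma map_wedge_mx (R S : comPzRingType) (phi : {rmorphism R -> S}) n (i : 'I_n) :
  map_mx phi (wedge_mx R i) = wedge_mx S i.
Proof.
apply/matrixP => p q; rewrite !mxE /=; case: ifP => _; last exact: rmorph0.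
by rewrite rmorphXn rmorphN1.
Qed.

Lemma map_form_mx (R S : comPzRingType) (phi : {rmorphism R -> S}) n (u : 'rV[R]_n) :
  map_mx phi (form_mx u) = form_mx (map_mx phi u).
Proof.
apply/matrixP => p q; rewrite mxE !summxE rmorph_sum; apply: eq_bigr => i _ /=.
by rewrite -(map_wedge_mx phi) !mxE rmorphM.
Qed.

Lemma map_nonface_mx (R S : comPzRingType) (phi : {rmorphism R -> S}) n
    (Delta : {set {set 'I_n}}) :
  map_mx phi (nonface_mx R Delta) = nonface_mx S Delta.
Proof. by apply/matrixP => p q; rewrite !mxE rmorph_nat. Qed.

Section LinearForms.
Variables (K : fieldType) (n : nat).
Local Notation E := (extalg K n).
Local Notation N := #|{set 'I_n}|.
Implicit Types (x y : E) (u w : 'rV[K]_n) (F G : {set 'I_n}).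

Definition ext_row x : 'rV[K]_N := \row_q x (enum_val q).
Definition row_ext (r : 'rV[K]_N) : E := [ffun F => r 0 (enum_rank F)].

Lemma row_extK : cancel row_ext ext_row.
Proof. by move=> r; apply/rowP => q; rewrite mxE ffunE enum_valK. Qed.

Lemma ext_rowK : cancel ext_row row_ext.
Proof. by move=> x; apply/ffunP => F; rewrite ffunE mxE enum_rankK. Qed.

Fact ext_row_is_linear : linear ext_row.
Proof. by move=> c x y; apply/rowP => q; rewrite !mxE !ffunE. Qed.
HB.instance Definition _ := GRing.isLinear.Build K E 'rV[K]_N _ ext_row
  ext_row_is_linear.

Definition linear_form u : E := \sum_i u 0 i *: ext_gen K i.

Lemma ext_basis_sum x : x = \sum_F x F *: ext_basis K F.
Proof.
apply/ffunP => F; rewrite sum_ffunE (bigD1 F) //= big1 => [|G /negPf nGF].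
  by rewrite !ffunE eqxx addr0 /GRing.scale /= mulr1.
by rewrite !ffunE eq_sym nGF /GRing.scale /= mulr0.
Qed.

Lemma ext_row_basis F : ext_row (ext_basis K F) = delta_mx 0 (enum_rank F).
Proof.
apply/rowP => q; rewrite !mxE ffunE eqxx -(inj_eq enum_rank_inj) enum_valK.
by rewrite eq_sym.
Qed.

Lemma ext_row_gen_mul i x :
  ext_row (ext_gen K i * x) = ext_row x *m wedge_mx K i.
Proof.
rewrite [x in LHS]ext_basis_sum [x in RHS]ext_basis_sum mulr_sumr !linear_sum.
rewrite mulmx_suml; apply: eq_bigr => F _.
rewrite -scalerAr !linearZ /= -scalemxAl; congr (_ *: _).
rewrite ext_row_basis -rowE /ext_gen ext_basisM disjoints1.
apply/rowP => q; rewrite !mxE /= enum_rankK; case: (boolP (i \notin F)) => iF.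
  rewrite /= !ffunE /GRing.scale /=.
  by case: eqP; rewrite ?mulr1 ?mulr0.
by rewrite /= ffunE.
Qed.

Lemma ext_row_form_mul u x :
  ext_row (linear_form u * x) = ext_row x *m form_mx u.
Proof.
rewrite mulr_suml linear_sum mulmx_sumr; apply: eq_bigr => i _.
by rewrite -scalerAl linearZ /= ext_row_gen_mul scalemxAr.
Qed.

Lemma ext_gen_anticomm (i j : 'I_n) : ext_gen K i * ext_gen K j = - (ext_gen K j * ext_gen K i).
Proof.
rewrite /ext_gen !ext_basisM !disjoints1 !inE eq_sym.
have [->|neq] := eqVneq i j; first by rewrite /= oppr0.
rewrite finset.setUC !inversionsE !big_set1 -scaleNr; congr (_ *: _).
case: (ltngtP i j) => [ij|ij|/val_inj ij]; last by rewrite ij eqxx in neq.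
  by rewrite expr0 expr1 opprK.
by rewrite expr0 expr1.
Qed.

Lemma ext_gen_sqr (i : 'I_n) : ext_gen K i * ext_gen K i = 0.
Proof. by rewrite /ext_gen ext_basisM disjoints1 inE eqxx. Qed.

Lemma linear_form_sqr u : linear_form u * linear_form u = 0.
Proof.
apply: sum_sqr0 => [i|i j]; rewrite -!scalerAl -!scalerAr.
  by rewrite ext_gen_sqr !scaler0.
by rewrite ext_gen_anticomm !scalerN !scalerA mulrC.
Qed.

Lemma linear_form_anticomm u w :
  linear_form u * linear_form w = - (linear_form w * linear_form u).
Proof.
rewrite /linear_form mulr_suml -[RHS]mulNr -sumrN mulr_suml.
under eq_bigr => i _ do rewrite mulr_sumr.
under [RHS]eq_bigr => i _ do rewrite mulr_sumr.
rewrite exchange_big; apply: eq_bigr => i _; apply: eq_bigr => j _ /=.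
rewrite mulNr -!scalerAl -!scalerAr ext_gen_anticomm !scalerN !scalerA.
by rewrite mulrC.
Qed.

Lemma form_mxP (A B : 'M[K]_N) :
  (forall x, ext_row x *m A = ext_row x *m B) -> A = B.
Proof.
move=> AB; apply/row_matrixP => p; rewrite !rowE -[delta_mx 0 p]row_extK.
exact: AB.
Qed.

Lemma form_mx_sqr u : form_mx u *m form_mx u = 0.
Proof.
apply: form_mxP => x; rewrite mulmxA -!ext_row_form_mul mulrA linear_form_sqr.
by rewrite mul0r linear0 mulmx0.
Qed.

Lemma form_mx_anticomm u w : form_mx u *m form_mx w = - (form_mx w *m form_mx u).
Proof.
apply: form_mxP => x; rewrite mulmxN !mulmxA -!ext_row_form_mul !mulrA.
by rewrite linear_form_anticomm mulNr linearN.
Qed.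

Lemma homogeneous1P x : homogeneous 1 x <-> exists u, x = linear_form u.
Proof.
split=> [x1 | [u ->] F].
  exists (\row_i x [set i]%SET); apply/ffunP => F; rewrite sum_ffunE.
  have [/cards1P[i ->]|nF1] := boolP (#|F| == 1)%N.
    rewrite (bigD1 i) //= big1 => [|j ji]; rewrite !ffunE /GRing.scale /= mxE.
      by rewrite eqxx mulr1 addr0.
    by rewrite (inj_eq finset.set1_inj) eq_sym (negPf ji) mulr0.
  rewrite big1 => [|i _].
    by apply/eqP/idPn => /x1 F1; rewrite F1 in nF1.
  rewrite !ffunE /GRing.scale /= [_ == _]negbTE ?mulr0 //.
  by apply: contra nF1 => /eqP ->; rewrite cards1.
apply: contraNeq => F1; rewrite sum_ffunE big1 // => i _.
rewrite !ffunE /GRing.scale /= [_ == _]negbTE ?mulr0 //.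
by apply: contra F1 => /eqP ->; rewrite cards1.
Qed.

End LinearForms.

Lemma mul_nonface_mxE (K : fieldType) n (Delta : {set {set 'I_n}}) l
    (A : 'M[K]_(l, #|{set 'I_n}|)) p q :
  (A *m nonface_mx K Delta) p q = if enum_val q \in Delta then 0 else A p q.
Proof.
rewrite !mxE (bigD1 q) //= big1 => [|r rq]; last first.
  by rewrite mxE (negPf rq) mulr0.
by rewrite mxE eqxx addr0 /=; case: ifP; rewrite ?mulr0 ?mulr1.
Qed.

(** The ranks for Delta and for its complement are at most the numbers of their nonfaces. These
    numbers add up to the size of the identity matrix, which is the sum of the two matrices, so both
    bounds are attained. *)
Lemma rank_nonface_mx (K : fieldType) n (Delta : {set {set 'I_n}}) :
  \rank (nonface_mx K Delta) = (#|{set 'I_n}| - #|Delta|)%N.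
Proof.
have le (D : {set {set 'I_n}}) : (\rank (nonface_mx K D) <= #|~: D|)%N.
  have sub : (nonface_mx K D <= \sum_(F in ~: D) <<delta_mx 0%R (enum_rank F) : 'rV[K]__>>)%MS.
    apply/row_subP => p.
    have -> : row p (nonface_mx K D) =
        (enum_val p \notin D)%:R *: delta_mx 0 (enum_rank (enum_val p)).
      apply/rowP => q; rewrite !mxE enum_valK eq_sym /= mulrC.
      by case: eqP; rewrite ?mul1r ?mul0r.
    have [pD|pD] := boolP (enum_val p \in D); first by rewrite scale0r sub0mx.
    by rewrite scale1r (sumsmx_sup (enum_val p)) ?inE ?genmxE.
  apply: leq_trans (mxrankS sub) _; apply: leq_trans (mxrank_sum_leqif _) _.
  rewrite /= (eq_bigr (fun=> 1%N)) ?sum1_card // => F _.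
  by rewrite genmxE mxrank_delta.
have : (#|{set 'I_n}| <= \rank (nonface_mx K Delta) + \rank (nonface_mx K (~: Delta)))%N.
  have [le_add _] := mxrank_adds_leqif (nonface_mx K Delta) (nonface_mx K (~: Delta)).
  apply: leq_trans le_add; rewrite -[leqLHS](mxrank1 K); apply: mxrankS.
  suff -> : 1%:M = nonface_mx K Delta + nonface_mx K (~: Delta) by apply: addmx_sub_adds.
  apply/matrixP => p q; rewrite !mxE inE negbK; case: eqP => _; rewrite ?addr0 //=.
  by case: (_ \in _); rewrite ?addr0 ?add0r.
have := le Delta; have := le (~: Delta); rewrite setCK.
have := cardsC Delta; move: (\rank _) (\rank _) => r1 r2 <-; lia.
Qed.

(** * Ideals generated by linear forms, and regularity as a dimension count *)

Section FormIdeals.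
Variables (K : fieldType) (n : nat) (Delta : {set {set 'I_n}}).
Local Notation E := (extalg K n).
Local Notation N := #|{set 'I_n}|.
Local Notation J := (nonface_mx K Delta).
Implicit Types (x y : E) (u w : 'rV[K]_n) (us ws : seq 'rV[K]_n).

Lemma sub_nonface_mxP l (A : 'M[K]_(l, N)) :
  reflect (forall p q, enum_val q \in Delta -> A p q = 0) (A <= J)%MS.
Proof.
apply: (iffP submxP) => [[B ->] p q qD | A0]; first by rewrite mul_nonface_mxE qD.
exists A; apply/matrixP => p q; rewrite mul_nonface_mxE.
by case: ifP => // /A0 ->.
Qed.

Lemma sub_nonface_rowP x :
  reflect (forall F, F \in Delta -> x F = 0) (ext_row x <= J)%MS.
Proof.
apply: (iffP (sub_nonface_mxP _)) => [x0 F FD | x0 p q qD].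
  by have := x0 0 (enum_rank F); rewrite mxE enum_rankK => ->.
by rewrite mxE x0.
Qed.

Hypothesis cplx : simplicial_complex Delta.

Lemma nonface_form_stable u : (J *m form_mx u <= J)%MS.
Proof.
rewrite mulmx_sumr summx_sub // => i _; rewrite -scalemxAr scalemx_sub //.
apply/sub_nonface_mxP => p q qD; rewrite mxE big1 // => r _; rewrite !mxE /=.
case: ifP => [/andP[_ /eqP qE]|]; last by rewrite mulr0.
have rD : enum_val r \in Delta by apply: cplx qD _; rewrite qE finset.subsetUr.
by case: eqP => [->|_]; rewrite ?rD mul0r.
Qed.

(* The ideal J_Delta + (us) of E, as a row space. *)
Definition form_ideal us : 'M[K]_N := (J + \sum_(u <- us) form_mx u)%MS.

Definition corank us : nat := (N - \rank (form_ideal us))%N.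

(** This numerical form of regularity, matched with [regular_sequence] in [regular_sequence_forms],
    is visibly independent of the order of the forms and depends only on their number and the ideal
    they generate; the exchange argument relies on both. *)
Definition regular_forms us : Prop := (corank us * 2 ^ size us = #|Delta|)%N.

Lemma form_ideal_rcons us u :
  (form_ideal (rcons us u) :=: form_ideal us + form_mx u)%MS.
Proof.
rewrite /form_ideal -cats1 big_cat big_seq1 /=.
by apply/eqmxP; rewrite addsmxA submx_refl.
Qed.

Lemma form_ideal_perm us ws : perm_eq us ws -> form_ideal us = form_ideal ws.
Proof. by move=> e; rewrite /form_ideal (perm_big _ e). Qed.

(** Anticommutation lets u act first, so the row space of each [form_mx w] is stable. *)
Lemma form_ideal_stable us u : (form_ideal us *m form_mx u <= form_ideal us)%MS.
Proof.
rewrite addsmxMr addsmx_sub (submx_trans (nonface_form_stable u)) ?addsmxSl //=.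
rewrite /form_ideal; elim: us => [|w us IHus].
  by rewrite big_nil mul0mx sub0mx.
rewrite big_cons addsmxMr addsmx_sub; apply/andP; split.
  rewrite form_mx_anticomm -mulNmx; apply: submx_trans (submxMl _ _) _.
  by rewrite addsmxC -addsmxA addsmxSl.
by apply: submx_trans IHus _; apply: addsmxS (submx_refl _) (addsmxSr _ _).
Qed.

Lemma corank_nil : corank [::] = #|Delta|.
Proof.
rewrite /corank /form_ideal big_nil addsmx0 rank_nonface_mx.
by rewrite subKn // max_card.
Qed.

Lemma corank_rcons_le us u : (corank us <= 2 * corank (rcons us u))%N.
Proof.
rewrite /corank form_ideal_rcons.
exact: corank_square_zero_le (form_ideal_stable us u) (form_mx_sqr u).
Qed.

Lemma corank_ge us : (#|Delta| <= corank us * 2 ^ size us)%N.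
Proof.
elim/last_ind: us => [|us u IHus]; first by rewrite corank_nil muln1.
apply: leq_trans IHus _; rewrite size_rcons expnS mulnA.
by rewrite leq_mul2r (mulnC _ 2) corank_rcons_le orbT.
Qed.

(** The bounds [corank_ge] and [corank_rcons_le] chain to the assumed equality, so each of them is
    an equality. *)
Lemma regular_forms_rcons us u : regular_forms (rcons us u) ->
  regular_forms us /\ corank us = (2 * corank (rcons us u))%N.
Proof.
rewrite /regular_forms size_rcons expnS mulnA => e.
have := corank_ge us; have := corank_rcons_le us u; rewrite -e.
rewrite leq_pmul2r ?expn_gt0 // (mulnC _ 2) => le1 le2.
have eq2 : (corank us = 2 * corank (rcons us u))%N.
  by apply/eqP; rewrite eqn_leq le1.
by split; rewrite // eq2.
Qed.

Lemma regular_forms_catl us ws : regular_forms (us ++ ws) -> regular_forms us.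
Proof.
elim/last_ind: ws => [|ws w IHws]; first by rewrite cats0.
by rewrite -rcons_cat => /regular_forms_rcons[/IHws].
Qed.

End FormIdeals.

(** * Exchange of regular sequences *)

Section Exchange.
Variables (K : fieldType) (n : nat) (Delta : {set {set 'I_n}}).
Local Notation N := #|{set 'I_n}|.
Implicit Types (u v w x : 'rV[K]_n) (us vs ws : seq 'rV[K]_n).
Hypothesis cplx : simplicial_complex Delta.
Hypothesis infK : forall k, exists2 s : seq K, uniq s & size s = k.
Local Notation regular := (regular_forms Delta).
Local Notation ideal := (form_ideal Delta).

Lemma regular_forms_perm us ws : perm_eq us ws -> regular us -> regular ws.
Proof.
move=> e; rewrite /regular_forms /corank (perm_size e) => <-.
by rewrite (form_ideal_perm _ e).
Qed.

Lemma form_ideal_cat us ws :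
  (ideal (us ++ ws) :=: ideal us + \sum_(w <- ws) form_mx w)%MS.
Proof.
rewrite /form_ideal big_cat /=.
by apply/eqmxP; rewrite addsmxA submx_refl.
Qed.

Lemma regular_forms_eq_span us ws ws' : size ws = size ws' ->
  (\sum_(w <- ws) form_mx w :=: \sum_(w <- ws') form_mx w)%MS ->
  regular (us ++ ws) -> regular (us ++ ws').
Proof.
move=> eqs eqw; rewrite /regular_forms /corank !size_cat eqs => <-.
rewrite form_ideal_cat form_ideal_cat.
by rewrite (adds_eqmx (eqmx_refl _) eqw).
Qed.

(** This is [pencil_exchange] on the quotient by [ideal us], where v is regular and w1, w2 form a
    regular pair. *)
Lemma regular_forms_pencil us v w1 w2 : regular (rcons us v) ->
  regular (us ++ [:: w1; w2]) ->
  exists c, regular (us ++ [:: v; w1 + c *: w2]).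
Proof.
move=> rv; rewrite -cat_rcons cats1 => rw.
have [rus cv] := regular_forms_rcons cplx rv.
have [/(regular_forms_rcons cplx)[_ cw1] cw2] := regular_forms_rcons cplx rw.
have [m [Q [P [PQ QI]]]] := quot_projection_exists (ideal us).
have st u := form_ideal_stable cplx us u.
have [] := pencil_exchange_quot PQ QI infK (st v) (st w1) (st w2)
  (form_mx_sqr v) (form_mx_sqr w1) (form_mx_sqr w2) (form_mx_anticomm _ _)
  (form_mx_anticomm _ _) (form_mx_anticomm _ _).
- by move: cv; rewrite /corank form_ideal_rcons => ->.
- move: cw1; rewrite cw2 mulnA /corank => ->; congr (_ * (_ - _))%N.
  rewrite form_ideal_rcons.
  by rewrite (adds_eqmx (form_ideal_rcons _ _ _) (eqmx_refl _)) addsmxA.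
move=> c cE; exists c; rewrite -cat_rcons cats1 /regular_forms !size_rcons.
move: rus; rewrite /regular_forms !expnS !mulnA => <-; congr (_ * _)%N.
rewrite -mulnA mulnC [RHS]/corank -cE; congr (_ * (_ - _))%N.
rewrite form_ideal_rcons linearD linearZ /=.
by rewrite (adds_eqmx (form_ideal_rcons _ _ _) (eqmx_refl _)) addsmxA.
Qed.

(** A Steinitz exchange up to change of basis: v replaces one element x of a basis of the span of
    ws. When a form w is appended to ws, the pencil lemma replaces the pair x, w by v, x + c w, and
    w becomes the new element left out. *)
Lemma regular_forms_exchange1 us v ws : regular (rcons us v) ->
  regular (us ++ ws) -> ws != [::] ->
  exists ws' x, [/\ (size ws').+1 = size ws,
    (\sum_(w <- rcons ws' x) form_mx w :=: \sum_(w <- ws) form_mx w)%MS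
    & regular (us ++ v :: ws')].
Proof.
move=> rv; elim/last_ind: ws => // ws w IHws.
have [-> | ws0] := eqVneq ws [::].
  by exists [::], w; split; rewrite ?cats1.
rewrite -rcons_cat => rw _.
have [ws' [x [sz spanE rvws]]] := IHws (regular_forms_rcons cplx rw).1 ws0.
(* After us ++ ws' the form v is regular by induction, and so is the pair x, w, because ws', x has
   the same span as the forms preceding w. *)
have [c rc] : exists c, regular ((us ++ ws') ++ [:: v; x + c *: w]).
  apply: regular_forms_pencil.
    apply: regular_forms_perm rvws.
    by rewrite -cats1 -catA perm_cat2l -cat1s perm_catC.
  rewrite -catA; move: rw; rewrite rcons_cat; apply: regular_forms_eq_span.
    by rewrite size_rcons size_cat /= -sz addn2.
  rewrite -cats1 -(cat_rcons x) !big_cat !big_seq1 /=.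
  exact: adds_eqmx (eqmx_sym spanE) (eqmx_refl _).
exists (rcons ws' (x + c *: w)), w; split.
- by rewrite !size_rcons sz.
- apply: eqmx_trans (_ : _ :=: \sum_(y <- rcons (rcons ws' x) w) form_mx y)%MS _.
    rewrite -!cats1 !big_cat !big_seq1 /= linearD linearZ /= -!addsmxA.
    apply: adds_eqmx (eqmx_refl _) _; apply/eqmxP; rewrite !addsmx_sub.
    rewrite !addsmxSr !andbT; apply/andP; split.
      by apply: addmx_sub_adds => //; rewrite scalemx_sub.
    rewrite -{1}[form_mx x](addrK (c *: form_mx w)) addmx_sub_adds //.
    by rewrite -scaleNr scalemx_sub.
  rewrite -!(cats1 _ w) !big_cat !big_seq1 /=.
  exact: adds_eqmx spanE (eqmx_refl _).
apply: regular_forms_perm rc; rewrite -catA perm_cat2l -cats1 -cat_cons.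
by rewrite -(cat_rcons v ws') perm_cat2r perm_rcons.
Qed.

(** The first form v of vs moves into the common prefix, after being exchanged into the longer
    sequence, which thereby gets shorter by one as well. *)
Lemma regular_forms_exchange us vs ws : (size vs < size ws)%N ->
  regular (us ++ vs) -> regular (us ++ ws) -> exists w, regular (us ++ rcons vs w).
Proof.
elim: vs us ws => [|v vs IHvs] us ws.
  case: ws => // w ws _ _; rewrite -cat_rcons => /(regular_forms_catl cplx).
  by rewrite -cats1; exists w.
move=> lt_s; rewrite -cat_rcons => rv rw.
have [|ws' [x [sz _ rvws]]] := regular_forms_exchange1 (regular_forms_catl cplx rv) rw.
  by case: (ws) lt_s.
have [||w rw'] := IHvs (rcons us v) ws' _ rv; first by rewrite -ltnS sz.
  by rewrite cat_rcons.
by exists w; rewrite rcons_cons -cat_rcons.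
Qed.

End Exchange.

(** * Regular sequences on the face ring *)

Section FaceRing.
Variables (K : fieldType) (n : nat) (Delta : {set {set 'I_n}}).
Local Notation E := (extalg K n).
Local Notation J := (nonface_mx K Delta).
Local Notation M := (face_ring K Delta).
Implicit Types (x y : E) (u w : 'rV[K]_n) (us ws : seq 'rV[K]_n).
Hypothesis cplx : simplicial_complex Delta.
Local Notation ideal := (form_ideal Delta).

Definition face_class x : M := quot_proj (nonface_monomials K Delta) (x : E^o).

Lemma submodule_sum (R : pzRingType) (V : lmodType R) (P : set V) (I : finType)
    (x : I -> V) :
  submodule P -> (forall i, P (x i)) -> P (\sum_i x i).
Proof.
move=> [P0 PP] Px; elim/big_ind: _ => // y z Py Pz.
by rewrite -[y]scale1r; apply: PP.
Qed.

(** Elements with zero coefficients at all faces form a submodule containing the multiples of e_G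
    for a nonface G, because subsets of faces are faces. Conversely every term of such an element is
    a scalar multiple of a generator. *)
Lemma ideal_nonfaceP x :
  ideal_mul (nonface_monomials K Delta) (x : E^o) <-> (ext_row x <= J)%MS.
Proof.
split=> [/(_ (fun y : E => forall F, F \in Delta -> y F = 0)) Jx | /sub_nonface_rowP x0].
  apply/sub_nonface_rowP/Jx => [|_ y [G nG ->] H HD].
    split=> [F _|a y z y0 z0 F FD]; first by rewrite ffunE.
    rewrite ffunE z0 // addr0 /GRing.scale /= /GRing.mul /= ffunE big1 // => G GF.
    by rewrite y0 ?mulr0 //; apply: cplx FD _; exact: finset.subsetDl.
  rewrite wedge_gen /GRing.scale /= /GRing.mul /= ffunE big1 // => F FH.
  rewrite ffunE; case: eqP => [FG|_]; last by rewrite mul0r mulr0.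
  by move: nG; rewrite -FG (cplx HD FH).
move=> P subP SP; rewrite [x]ext_basis_sum; apply: (@submodule_sum E E^o) => // F.
have [FD|nFD] := boolP (F \in Delta); first by rewrite x0 // scale0r; case: subP.
have -> : x F *: ext_basis K F = ext_basis K F * ((x F : K) *: 1 : E).
  by rewrite -scalerAr mulr1.
by apply: (SP (ext_basis K F) ((x F : K) *: 1 : E)); exists F; rewrite ?wedge_gen.
Qed.

Lemma face_class_eq x y : face_class x = face_class y <-> (ext_row (x - y) <= J)%MS.
Proof. exact: iff_trans (quot_proj_eq _ _ _) (ideal_nonfaceP _). Qed.

Lemma face_classD x y : face_class (x + y) = face_class x + face_class y.
Proof. exact: quot_projD. Qed.

Lemma face_classZ (a : E) x : face_class (a * x) = a *: face_class x.
Proof. exact: (quot_projZ _ (M := E^o)). Qed.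

Lemma face_classP (q : M) : exists x, q = face_class x.
Proof. exact: (@quot_projP E (nonface_monomials K Delta) E^o q). Qed.

Lemma linear_form_delta i : linear_form (delta_mx 0 i : 'rV[K]_n) = ext_gen K i.
Proof.
rewrite /linear_form (bigD1 i) //= mxE !eqxx scale1r big1 ?addr0 // => j ji.
by rewrite mxE eqxx (negPf ji) scale0r.
Qed.

Lemma form_ideal_mul us (a : E) x :
  (ext_row x <= ideal us)%MS -> (ext_row (a * x)%R <= ideal us)%MS.
Proof.
move=> xI; rewrite [a]ext_basis_sum mulr_suml linear_sum summx_sub // => F _.
rewrite -scalerAl linearZ /= scalemx_sub // -wedge_gen /wedge.
elim: (enum F) => [|i s IHs]; first by rewrite big_nil mul1r.
rewrite big_cons -mulrA -linear_form_delta ext_row_form_mul.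
exact: submx_trans (submxMr _ IHs) (form_ideal_stable cplx _ _).
Qed.

(** The row space of [form_mx u] consists of the products u y, and together with J these are closed
    under left multiplication by [form_ideal_mul], so no further products are generated. *)
Lemma ideal_formsP us x :
  ideal_mul (fun v => v \in [seq linear_form u | u <- us]) (face_class x) <->
  (ext_row x <= ideal us)%MS.
Proof.
split=> [Ix | xI P subP SP].
  pose P (q : M) := exists2 y, q = face_class y & (ext_row y <= ideal us)%MS.
  have [||y xy yI] := Ix P.
  - split=> [|a _ _ [y -> yI] [z -> zI]].
      by exists 0; rewrite ?linear0 ?sub0mx //; exact/esym/raddf0.
    exists (a * y + z); first by rewrite face_classD face_classZ.
    by rewrite linearD addmx_sub // form_ideal_mul.
  - move=> v q /mapP[u us_u ->]; have [y ->] := face_classP q.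
    exists (linear_form u * y); first by rewrite face_classZ.
    rewrite ext_row_form_mul /form_ideal; apply: submx_trans (submxMl _ _) _.
    by apply: submx_trans (addsmxSr _ _); rewrite (big_rem u) //= addsmxSl.
  rewrite -[x](subrK y) linearD addmx_sub //.
  by apply: submx_trans (addsmxSl _ _); apply/face_class_eq.
(* The induction runs over a list vs of forms taken from us, while the submodule generated by us
   stays fixed. *)
have: {subset us <= us} by [].
move: {1 2}us xI => vs; elim/last_ind: vs x => [|vs u IHvs] x.
  rewrite /form_ideal big_nil addsmx0 => xJ _.
  suff -> : face_class x = 0 by case: subP.
  by rewrite -[RHS](_ : face_class 0 = 0); [apply/face_class_eq; rewrite subr0 | exact: raddf0].
rewrite form_ideal_rcons => /sub_addsmxP[[r1 r2] /= xE] vsus.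
have -> : x = row_ext (r1 *m ideal vs) + linear_form u * row_ext r2.
  by apply: (can_inj (@ext_rowK K n)); rewrite linearD /= ext_row_form_mul !row_extK.
rewrite face_classD face_classZ -[face_class (row_ext _)]scale1r.
apply: subP.2; last by apply: SP; apply/map_f/vsus; rewrite mem_rcons inE eqxx.
apply: IHvs => [|w w_vs]; first by rewrite row_extK submxMl.
by apply: vsus; rewrite mem_rcons inE w_vs orbT.
Qed.

Definition form_class us x : quot_mod (fun v => v \in [seq linear_form u | u <- us]) M :=
  quot_proj _ (face_class x).

Lemma form_classP us q : exists x, q = form_class us x.
Proof.
have [m ->] := quot_projP q; have [x ->] := face_classP m.
by exists x.
Qed.

Lemma form_class_eq us x y :
  form_class us x = form_class us y <-> (ext_row (x - y) <= ideal us)%MS.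
Proof.
apply: iff_trans (quot_proj_eq _ _ _) _.
rewrite -[face_class x - _](quot_projB _ (x : E^o) y).
exact: ideal_formsP.
Qed.

Lemma form_class0 us : form_class us 0 = 0.
Proof. by rewrite /form_class (_ : face_class 0 = 0) ?raddf0 //; exact: raddf0. Qed.

Lemma form_classZ us (a : E) x : form_class us (a * x) = a *: form_class us x.
Proof. by rewrite /form_class face_classZ quot_projZ. Qed.

(** Annihilator and image of the form in the quotient module become the kernel and image conditions
    of [corank_square_zeroP] modulo [ideal us]. *)
Lemma regular_elementP us u :
  regular_element (quot_mod (fun v => v \in [seq linear_form w | w <- us]) M)
    (linear_form u) <-> corank Delta us = (2 * corank Delta (rcons us u))%N.
Proof.
have stageP := corank_square_zeroP (form_ideal_stable cplx us u) (form_mx_sqr u).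
have zeroP x : linear_form u *: form_class us x = 0 <->
    (ext_row x *m form_mx u <= ideal us)%MS.
  rewrite -form_classZ -(form_class0 us) -ext_row_form_mul -{2}[_ * x]subr0.
  exact: form_class_eq.
have imageP x : (exists m, form_class us x = linear_form u *: m) <->
    (ext_row x <= ideal us + form_mx u)%MS.
  split=> [[m] | /sub_addsmxP[[r1 r2] /= xE]].
    have [y ->] := form_classP m; rewrite -form_classZ => /form_class_eq xy.
    rewrite -[x](subrK (linear_form u * y)) linearD /= ext_row_form_mul.
    by rewrite addmx_sub_adds // submxMl.
  exists (form_class us (row_ext r2)); rewrite -form_classZ; apply/form_class_eq.
  by rewrite linearB /= ext_row_form_mul row_extK xE addrK submxMl.
have im_ker x : (ext_row x <= ideal us + form_mx u)%MS ->
    (ext_row x *m form_mx u <= ideal us)%MS.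
  case/sub_addsmxP=> [[r1 r2] /= ->]; rewrite mulmxDl -[X in _ + X]mulmxA.
  rewrite form_mx_sqr mulmx0 addr0 -mulmxA mulmx_sub //.
  exact: form_ideal_stable.
rewrite /corank form_ideal_rcons; split=> [reg | /eqP/stageP reg m].
  apply/eqP/stageP => r; rewrite -[r]row_extK => /zeroP/reg; exact: (imageP _).1.
have [x ->] := form_classP m; split=> [/zeroP/reg/imageP // | /imageP/im_ker/zeroP //].
Qed.

Lemma form_quotient_neq0 us :
  (exists q : quot_mod (fun v => v \in [seq linear_form w | w <- us]) M, q <> 0) <->
  (0 < corank Delta us)%N.
Proof.
rewrite /corank subn_gt0 ltn_neqAle rank_leq_col andbT.
rewrite -[_ == _]/(row_full _) -sub1mx; split=> [[q] | /row_subPn[i ni]].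
  have [x ->] := form_classP q; apply: contra_notN => full.
  rewrite -(form_class0 us); apply/form_class_eq.
  exact: submx_trans (submx1 _) full.
exists (form_class us (row_ext (row i 1%:M))).
rewrite -(form_class0 us) => /form_class_eq; rewrite subr0 row_extK.
exact/negP.
Qed.

(** The equalities at the successive stages multiply up to the dimension count. The last quotient
    has dimension |Delta| / 2^s, so its nonvanishing amounts to Delta being nonempty. *)
Lemma regular_sequence_forms us :
  regular_sequence M [seq linear_form u | u <- us] <->
  regular_forms Delta us /\ (0 < #|Delta|)%N.
Proof.
have gt0 ws : regular_forms Delta ws -> (0 < corank Delta ws)%N = (0 < #|Delta|)%N.
  by move=> <-; rewrite muln_gt0 expn_gt0 andbT.
split=> [[_ reg /form_quotient_neq0 c0] | [reg D0]].
  have rus : regular_forms Delta us.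
    rewrite -[us]take_size; elim: {-2}(size us) (leqnn (size us)) => [|i IHi] i_us.
      by rewrite take0 /regular_forms corank_nil muln1.
    have := reg i; rewrite size_map i_us => /(_ isT).
    rewrite -map_take (nth_map 0) // => /regular_elementP.
    rewrite -take_nth // => ci; have := IHi (ltnW i_us).
    by rewrite /regular_forms !size_takel ?(ltnW i_us) // ci expnS mulnA (mulnC _ 2).
  by rewrite -(gt0 us).
split.
- by move=> v /mapP[u _ ->]; apply/homogeneous1P; exists u.
- rewrite size_map => i i_us; rewrite -map_take (nth_map 0) //.
  apply/regular_elementP.
  have : regular_forms Delta (take i.+1 us).
    by apply: (@regular_forms_catl _ _ _ cplx _ (drop i.+1 us)); rewrite cat_take_drop.
  by rewrite (take_nth 0) // => /(regular_forms_rcons cplx)[].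
by apply/form_quotient_neq0; rewrite gt0.
Qed.

Lemma regular_sequenceP vs : regular_sequence M vs ->
  exists us, vs = [seq linear_form u | u <- us].
Proof.
case=> lin _ _; elim: vs lin => [|v vs IHvs] lin; first by exists [::].
have /homogeneous1P[u ->] := lin v (mem_head _ _).
have [w w_vs|us ->] := IHvs; first by apply: lin; rewrite inE w_vs orbT.
by exists (u :: us).
Qed.

End FaceRing.

(** * Ranks under specialization *)

Section RankSpecialization.

Lemma unit_minor_exists (K : fieldType) m p (A : 'M[K]_(m, p)) :
  exists (f : 'I_(\rank A) -> 'I_m) (g : 'I_(\rank A) -> 'I_p),
    mxsub f g A \in unitmx.
Proof.
have full : row_full (rowsub (maxrankfun A) A)^T.
  by rewrite /row_full mxrank_tr; exact: maxrowsub_free.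
exists (maxrankfun A), (fullrankfun full).
rewrite -unitmx_tr; have := fullrowsub_unit full.
by rewrite (_ : rowsub _ _ = (mxsub (maxrankfun A) (fullrankfun full) A)^T) //;
  apply/matrixP => i j; rewrite !mxE.
Qed.

Lemma unit_minor_rank (K : fieldType) m p r (A : 'M[K]_(m, p))
    (f : 'I_r -> 'I_m) (g : 'I_r -> 'I_p) :
  mxsub f g A \in unitmx -> (r <= \rank A)%N.
Proof.
rewrite -row_full_unit => /eqP {1}<-.
have -> : mxsub f g A = rowsub f 1%:M *m A *m colsub g 1%:M.
  by rewrite -rowsubE mulmx_colsub mulmx1 -mxsub_comp.
exact: leq_trans (mxrankM_maxl _ _) (mxrankM_maxr _ _).
Qed.

(** A minor that is nonzero under phi is nonzero in R, hence nonzero under the injective psi. *)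
Lemma rank_specialize (R : comNzRingType) (L L' : fieldType)
    (phi : {rmorphism R -> L}) (psi : {rmorphism R -> L'}) m p (A : 'M[R]_(m, p)) :
  (forall x, psi x = 0 -> x = 0) -> (\rank (map_mx phi A) <= \rank (map_mx psi A))%N.
Proof.
move=> psi0; have [f [g]] := unit_minor_exists (map_mx phi A).
rewrite unitmxE unitfE -map_mxsub det_map_mx => phi_n0.
apply: (unit_minor_rank (f := f) (g := g)).
rewrite unitmxE unitfE -map_mxsub det_map_mx.
by apply: contra_neq phi_n0 => /psi0 ->; rewrite rmorph0.
Qed.

(** The same argument with a family of evaluations: one of them has to detect a single nonzero
    minor. *)
Lemma rank_evaluation (R : comNzRingType) (L L' : fieldType)
    (phi : {rmorphism R -> L}) (I : Type) (psi : I -> {rmorphism R -> L'})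
    m p (A : 'M[R]_(m, p)) :
  (forall x, x != 0 -> exists i, psi i x != 0) ->
  exists i, (\rank (map_mx phi A) <= \rank (map_mx (psi i) A))%N.
Proof.
move=> psi_n0; have [f [g]] := unit_minor_exists (map_mx phi A).
rewrite unitmxE unitfE -map_mxsub det_map_mx => phi_n0.
have [|i psi_i] := psi_n0 (\det (mxsub f g A)).
  by apply: contra_neq phi_n0 => ->; rewrite rmorph0.
exists i; apply: (unit_minor_rank (f := f) (g := g)).
by rewrite unitmxE unitfE -map_mxsub det_map_mx.
Qed.

End RankSpecialization.

(** Uniqueness of base b digits, which keeps distinct exponents distinct in Kronecker's
    substitution. *)
Lemma digits_inj b k (f g : nat -> nat) :
  (forall i, (i < k)%N -> (f i < b)%N) -> (forall i, (i < k)%N -> (g i < b)%N) ->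
  (\sum_(i < k) f i * b ^ i = \sum_(i < k) g i * b ^ i)%N ->
  forall i, (i < k)%N -> f i = g i.
Proof.
elim: k f g => // k IHk f g fb gb.
rewrite !big_ord_recl !muln1 => e.
have shift (h : nat -> nat) :
    (\sum_(i < k) h (bump 0 i) * b ^ (bump 0 i) = (\sum_(i < k) h i.+1 * b ^ i) * b)%N.
  rewrite big_distrl; apply: eq_bigr => i _ /=.
  by rewrite /bump add1n expnS mulnCA mulnC.
move: e; rewrite /= (shift f) (shift g) => e.
have f0 : f 0%N = g 0%N.
  have := congr1 (modn^~ b) e; rewrite /= ![(_ + _ * b)%N]addnC !modnMDl.
  by rewrite !modn_small ?fb ?gb.
case=> [//|i]; rewrite ltnS => ik.
apply: (IHk (fun i => f i.+1) (fun i => g i.+1)) => //.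
- by move=> j jk; apply: fb.
- by move=> j jk; apply: gb.
move/eqP: e; rewrite f0 eqn_add2l eqn_mul2r => /orP[/eqP b0|/eqP //].
by have := fb 0%N isT; rewrite b0.
Qed.

(* Kronecker's substitution X_i -> X^(b^i) with b larger than all exponents. *)
Lemma mpoly_nonroot (K : fieldType) k (p : {mpoly K[k]}) :
  (forall j, exists2 s : seq K, uniq s & size s = j) ->
  p != 0 -> exists v : 'I_k -> K, meval v p != 0.
Proof.
move=> infK p0; pose b := msize p.
pose e (m : 'X_{1..k}) := (\sum_(i < k) m i * b ^ i)%N.
pose q : {poly K} := \sum_(m <- msupp p) p@_m *: 'X^(e m).
have qE c : q.[c] = meval (fun i => c ^+ (b ^ i)) p.
  rewrite mevalE horner_sum; apply: eq_bigr => m _.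
  rewrite hornerZ hornerXn; congr (_ * _).
  rewrite /e expr_sum -?prodrXr; apply: eq_bigr => i _.
  by rewrite mulnC exprM.
have q0 : q != 0.
  have m0 := mlead_supp p0; apply/negP => /eqP/(congr1 (coefp (e (mlead p)))).
  rewrite /= coef0 coef_sum (big_rem _ m0) /= big1_seq => [|m /= ms].
    by rewrite coefZ coefXn eqxx mulr1 addr0 => /eqP; rewrite mleadc_eq0 (negPf p0).
  rewrite coefZ coefXn; case: eqP => [em|]; last by rewrite mulr0.
  move: ms; rewrite mem_rem_uniq ?msupp_uniq // inE => /andP[/eqP neq ms].
  have lt_b m' : m' \in msupp p -> forall i : 'I_k, (m' i < b)%N.
    move=> m's i; apply: leq_ltn_trans (msize_mdeg_lt m's).
    by rewrite mdegE (bigD1 i) //= leq_addr.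
  (* Exponents are extended by 0 beyond k, since [digits_inj] takes functions on all natural
     numbers. *)
  pose f (m' : 'X_{1..k}) (i : nat) := if insub i is Some j then m' j else 0%N.
  have fE m' (i : 'I_k) : f m' i = m' i by rewrite /f valK.
  have eE m' : e m' = (\sum_(i < k) f m' i * b ^ i)%N.
    by apply: eq_bigr => i _; rewrite fE.
  have f_lt m' : m' \in msupp p -> forall i, (i < k)%N -> (f m' i < b)%N.
    by move=> m's i ik; rewrite (fE _ (Ordinal ik)) lt_b.
  case: neq; apply/mnmP => i; rewrite -!fE.
  by apply: (digits_inj (f_lt _ ms) (f_lt _ m0)); rewrite -?eE.
have [s us ss] := infK (size q).
have [c _ qc] : exists2 c, c \in s & q.[c] != 0.
  apply/hasP; rewrite has_predC; apply/negP => /(max_poly_roots q0).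
  by move=> /(_ us); rewrite ss ltnn.
by exists (fun i => c ^+ (b ^ i)); rewrite -qE.
Qed.

(** * Coranks of generic forms *)

Section GenericForms.
Variables (n : nat) (Delta : {set {set 'I_n}}).
Local Notation N := #|{set 'I_n}|.

(** Row spaces need a field, so the generators of the ideal are stacked in one matrix that makes
    sense over polynomial rings and commutes with specialization. *)
Definition form_stack (R : comPzRingType) s (g : 'M[R]_(s, n)) :
    'M[R]_(N + \sum_(i < s) N, N) :=
  col_mx (nonface_mx R Delta) (\mxcol_(i < s) form_mx (row i g)).

Lemma map_form_stack (R S : comPzRingType) (phi : {rmorphism R -> S}) s
    (g : 'M[R]_(s, n)) :
  map_mx phi (form_stack g) = form_stack (map_mx phi g).
Proof.
rewrite /form_stack map_col_mx map_nonface_mx; congr col_mx.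
apply/mxcolP => i; rewrite mxcolK -map_row -map_form_mx.
rewrite -[in RHS](mxcolK (fun j => form_mx (row j g)) i).
by apply/matrixP => j k; rewrite !mxE.
Qed.

Definition row_seq (R : Type) s (g : 'M[R]_(s, n)) : seq 'rV[R]_n :=
  [seq row i g | i <- enum 'I_s].

Lemma size_row_seq (R : Type) s (g : 'M[R]_(s, n)) : size (row_seq g) = s.
Proof. by rewrite size_map size_enum_ord. Qed.

Lemma seq_row_seq (R : nmodType) (us : seq 'rV[R]_n) :
  us = row_seq (\matrix_(i < size us) us`_i).
Proof.
apply: (@eq_from_nth _ 0) => [|i i_us]; first by rewrite size_row_seq.
rewrite (nth_map (Ordinal i_us)) ?size_enum_ord // rowK.
by rewrite nth_enum_ord.
Qed.

Lemma corank_row_seq (K : fieldType) s (g : 'M[K]_(s, n)) :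
  corank Delta (row_seq g) = (N - \rank (form_stack g))%N.
Proof.
rewrite /corank -addsmxE; congr (_ - _)%N.
rewrite (adds_eqmx (eqmx_refl _) (eqmx_col _)) /form_ideal big_map big_enum /=.
apply: eqmx_rank; apply/eqmxP; apply: adds_eqmx (eqmx_refl _) _.
by apply: eqmx_sums => i _; apply: eqmx_sym; apply: genmxE.
Qed.

End GenericForms.

Section Genericity.
Variables (K K' : fieldType) (iota : {rmorphism K -> K'}) (n : nat).
Variables (a : 'M[K']_n) (Delta : {set {set 'I_n}}).
Hypothesis indep : alg_independent iota a.
Hypothesis infK : forall k, exists2 s : seq K, uniq s & size s = k.
Local Notation P := {mpoly K[n * n]}.

Definition entry_eval (L : fieldType) (f : {rmorphism K -> L}) (b : 'M[L]_n) :=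
  mmap f (fun k => mxvec b 0 k).

(** Algebraic independence makes evaluation at a injective, so ranks are largest there. *)
Lemma generic_rank (L : fieldType) (f : {rmorphism K -> L}) (b : 'M[L]_n) m p
    (A : 'M[P]_(m, p)) :
  (\rank (map_mx (entry_eval f b) A) <= \rank (map_mx (entry_eval iota a) A))%N.
Proof. exact: rank_specialize. Qed.

Definition entry_mx : 'M[P]_n := \matrix_(i, j) 'X_(mxvec_index i j).

Lemma map_entry_mx (L : fieldType) (f : {rmorphism K -> L}) (b : 'M[L]_n) :
  map_mx (entry_eval f b) entry_mx = b.
Proof. by apply/matrixP => i j; rewrite !mxE /entry_eval mmapX mmap1U mxvecE. Qed.

Definition top_rows (R : Type) s (le_sn : (s <= n)%N) (b : 'M[R]_n) : 'M[R]_(s, n) :=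
  rowsub (widen_ord le_sn) b.

Lemma top_rows_surj s (le_sn : (s <= n)%N) (g : 'M[K]_(s, n)) :
  exists b, top_rows le_sn b = g.
Proof.
exists (\matrix_(i, j) if insub (i : nat) is Some i' then g i' j else 0).
by apply/matrixP => i j; rewrite !mxE /= valK.
Qed.

Lemma corank_generic_le s (le_sn : (s <= n)%N) (g : 'M[K]_(s, n)) :
  (corank Delta (row_seq (top_rows le_sn a)) <= corank Delta (row_seq g))%N.
Proof.
have [b <-] := top_rows_surj le_sn g; rewrite !corank_row_seq leq_sub2l //.
have := generic_rank idfun b (form_stack Delta (top_rows le_sn entry_mx)).
by rewrite !map_form_stack /top_rows !map_mxsub !map_entry_mx.
Qed.

(** A maximal minor that is nonzero at a is a nonzero polynomial over K, and over an infinite field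
    such a polynomial has a nonzero value. *)
Lemma corank_generic_attained s (le_sn : (s <= n)%N) :
  exists g : 'M[K]_(s, n),
    (corank Delta (row_seq g) <= corank Delta (row_seq (top_rows le_sn a)))%N.
Proof.
have ev_n0 (p : P) : p != 0 -> exists b : 'M[K]_n, entry_eval idfun b p != 0.
  move=> /(mpoly_nonroot infK)[v pv]; exists (vec_mx (\row_k v k)).
  by rewrite /entry_eval vec_mxK; congr (_ != 0): pv; apply: meval_eq => k; rewrite mxE.
have [b] := rank_evaluation (entry_eval iota a)
  (form_stack Delta (top_rows le_sn entry_mx)) ev_n0.
rewrite !map_form_stack /top_rows !map_mxsub !map_entry_mx => le_rank.
by exists (top_rows le_sn b); rewrite !corank_row_seq leq_sub2l.
Qed.

End Genericity.

(** * The exterior shifting as a greedy basis *)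

Section LexOrder.
Variable n : nat.
Implicit Types A B C : {set 'I_n}.

Lemma lex_ltP A B :
  reflect (exists i : 'I_n, [/\ i \in A, i \notin B
    & forall j : 'I_n, (j < i)%N -> (j \in A) = (j \in B)]) (lex_lt A B).
Proof.
apply: (iffP existsP) => [[i /andP[]] | [i [iA iB eq_lt]]].
  rewrite inE => /andP[iB iA] /forallP min_i; exists i; split=> // j ji.
  have := min_i j; rewrite !inE leqNgt ji implybF negb_or.
  by case: (j \in A); case: (j \in B).
exists i; rewrite inE iB iA /=; apply/forallP => j; apply/implyP; rewrite !inE.
by rewrite leqNgt; apply: contraL => /eq_lt ->; case: (j \in B).
Qed.

Lemma lex_lt_irr A : lex_lt A A = false.
Proof. by apply/negbTE/negP => /lex_ltP[i [iA /negP]]. Qed.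

Lemma lex_lt_total A B : A != B -> lex_lt A B || lex_lt B A.
Proof.
move=> neq; pose D := (A :\: B) :|: (B :\: A).
have [i0 i0D] : exists i, i \in D.
  apply/set0Pn; apply: contra neq; rewrite /D finset.setU_eq0 !finset.setD_eq0.
  by move=> /andP[AB BA]; rewrite eqEsubset AB BA.
case: (@arg_minnP _ i0 (fun i => i \in D) (fun i : 'I_n => i : nat) i0D) => i iD min_i.
have eq_lt (j : 'I_n) : (j < i)%N -> (j \in A) = (j \in B).
  move=> ji; have : j \notin D by apply: contraL ji => /min_i; rewrite -leqNgt.
  by rewrite !inE; case: (j \in A); case: (j \in B).
have := iD; rewrite !inE => /orP[/andP[iB iA]|/andP[iA iB]]; apply/orP.
  by left; apply/lex_ltP; exists i.
by right; apply/lex_ltP; exists i; split=> // j /eq_lt.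
Qed.

Lemma lex_lt_trans A B C : lex_lt A B -> lex_lt B C -> lex_lt A C.
Proof.
move=> /lex_ltP[i [iA iB eqAB]] /lex_ltP[j [jB jC eqBC]].
apply/lex_ltP; have [ij|ji|/val_inj eqij] := ltngtP i j.
- exists i; split; rewrite // -?eqBC // => k ki.
  by rewrite eqAB // eqBC // (ltn_trans ki).
- exists j; split; rewrite // ?eqAB // => k kj.
  by rewrite eqAB ?eqBC // (ltn_trans kj).
by rewrite -eqij (negPf iB) in jB.
Qed.

(** The least element of A lies in [r], hence below every element of B. *)
Lemma lex_lt_initial r A B : ~~ [disjoint A & initial_segment n r] ->
  [disjoint B & initial_segment n r] -> lex_lt A B.
Proof.
rewrite -finset.setI_eq0 => /set0Pn[i0]; rewrite inE => /andP[i0A i0r] dB.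
case: (@arg_minnP _ i0 (fun i => i \in A) (fun i : 'I_n => i : nat) i0A) => i iA min_i.
have lt_r (j : 'I_n) : (j <= i0)%N -> j \notin B.
  move=> ji; apply/negP => jB; move/disjointFr: dB => /(_ j jB).
  by rewrite inE in i0r; rewrite inE (leq_ltn_trans ji).
apply/lex_ltP; exists i; split=> // [|j ji]; first by rewrite lt_r ?min_i.
rewrite [RHS](negPf (lt_r _ _)); last by rewrite ltnW // (leq_trans ji) ?min_i.
by apply/negbTE/negP => /min_i; rewrite leqNgt ji.
Qed.

(* The symmetric difference, hence the order, is unchanged by removing common
   elements. *)
Lemma lex_lt_translate A B A' B' :
  (forall i, (i \in A) (+) (i \in B) = (i \in A') (+) (i \in B')) ->
  (forall i, i \in A' -> i \notin B' -> i \in A) -> lex_lt A' B' -> lex_lt A B.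
Proof.
move=> eqD sub /lex_ltP[i [iA iB eq_lt]]; apply/lex_ltP; exists i.
have iA' := sub i iA iB; split=> // [|j ji].
  by have := eqD i; rewrite iA' iA (negPf iB) /=; case: (i \in B).
by have := eqD j; rewrite (eq_lt j ji) addbb; case: (j \in A); case: (j \in B).
Qed.

End LexOrder.

Section AnticommutingProducts.
Variables (R : pzRingType) (I : eqType) (x : I -> R).
Hypotheses (xx : forall i, x i * x i = 0) (xC : forall i j, x i * x j = - (x j * x i)).

Lemma sign_mulCA (b : bool) (y z : R) : y * ((-1) ^+ b * z) = (-1) ^+ b * (y * z).
Proof. by rewrite !mulrA; congr (_ * _); exact/commrX/commrN1. Qed.

(** Only the existence of a sign is recorded, since the products are used for the spaces they
    span. *)
Lemma prod_front (s : seq I) i : i \in s ->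
  exists b : bool, \prod_(j <- s) x j = (-1) ^+ b * (x i * \prod_(j <- rem i s) x j).
Proof.
elim: s => // j s IHs; rewrite inE /=; have [->|neq] := eqVneq j i.
  by exists false; rewrite big_cons mul1r.
move=> /= /IHs[b bE]; exists (~~ b).
by rewrite !big_cons bE sign_mulCA signrN [x j * (x i * _)]mulrA xC !mulNr mulrN -!mulrA.
Qed.

Lemma prod_perm (s t : seq I) : perm_eq s t ->
  exists b : bool, \prod_(j <- s) x j = (-1) ^+ b * \prod_(j <- t) x j.
Proof.
elim: s t => [|i s IHs] t st.
  have -> : t = [::] by apply/perm_nilP; rewrite perm_sym.
  by exists false; rewrite big_nil mul1r.
have i_t : i \in t by rewrite -(perm_mem st) mem_head.
have [b bE] := prod_front i_t.
have [c cE] : exists b : bool, \prod_(j <- s) x j = (-1) ^+ b * \prod_(j <- rem i t) x j.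
  by apply: IHs; rewrite -(perm_cons i) (perm_trans st) // perm_to_rem.
exists (b (+) c); rewrite big_cons cE bE sign_mulCA mulrA -signr_addb.
by rewrite addbAC addbb.
Qed.

Lemma prod_dup0 (s : seq I) : ~~ uniq s -> \prod_(j <- s) x j = 0.
Proof.
elim: s => // i s IHs; rewrite /= negb_and negbK big_cons => /orP[/prod_front|/IHs ->].
  by case=> b ->; rewrite sign_mulCA (mulrA (x i)) xx mul0r mulr0.
by rewrite mulr0.
Qed.

End AnticommutingProducts.

Section Families.
Variables (K : fieldType) (n : nat).
Local Notation E := (extalg K n).
Local Notation N := #|{set 'I_n}|.
Implicit Types (g : {set 'I_n} -> E) (P : pred {set 'I_n}).

(** Rows outside P are zero, so that all families give matrices of the same size. *)
Definition family_mx P g : 'M[K]_N :=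
  \matrix_(p < N) if P (enum_val p) then ext_row (g (enum_val p)) else 0.

Lemma family_mx_sub l P g (X : 'M_(l, N)) :
  reflect (forall C, P C -> (ext_row (g C) <= X)%MS) (family_mx P g <= X)%MS.
Proof.
apply: (iffP row_subP) => [sub C PC | sub p].
  by have := sub (enum_rank C); rewrite rowK enum_rankK PC.
by rewrite rowK; case: ifP => [/sub|_]; rewrite ?sub0mx.
Qed.

Lemma sub_family_mx P g C : P C -> (ext_row (g C) <= family_mx P g)%MS.
Proof. exact: (family_mx_sub P g _ (submx_refl _)). Qed.

Lemma mul_family_mx P g (r : 'rV_N) :
  r *m family_mx P g = ext_row (\sum_(C | P C) r 0 (enum_rank C) *: g C).
Proof.
rewrite mulmx_sum_row linear_sum [RHS]big_mkcond (reindex enum_rank) /=; last first.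
  by apply: onW_bij; exact: enum_rank_bij.
apply: eq_bigr => C _; rewrite rowK enum_rankK.
by case: ifP => _; rewrite ?linearZ ?scaler0.
Qed.

Lemma sub_adds_family_mx l P g (X : 'M_(l, N)) x :
  reflect (exists c : {set 'I_n} -> K,
      (ext_row (x - \sum_(C | P C) c C *: g C) <= X)%MS)
    (ext_row x <= X + family_mx P g)%MS.
Proof.
apply: (iffP idP) => [/sub_addsmxP[[r1 r2] /= xE] | [c sub]].
  exists (fun C => r2 0 (enum_rank C)).
  by rewrite linearB /= xE mul_family_mx addrK submxMl.
rewrite -[x](subrK (\sum_(C | P C) c C *: g C)) linearD /= addmx_sub_adds //.
rewrite linear_sum summx_sub // => C PC.
by rewrite linearZ scalemx_sub // sub_family_mx.
Qed.

End Families.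

Section FormMonomials.
Variables (K : fieldType) (n : nat) (a : 'M[K]_n) (Delta : {set {set 'I_n}}).
Local Notation E := (extalg K n).
Local Notation N := #|{set 'I_n}|.
Local Notation J := (nonface_mx K Delta).
Local Notation f := (generic_form a).
Local Notation fw := (wedge (generic_form a)).
Implicit Types (A B C F : {set 'I_n}) (x y : E).
Hypothesis cplx : simplicial_complex Delta.

Lemma generic_formE i : f i = linear_form (row i a).
Proof. by apply: eq_bigr => j _; rewrite mxE. Qed.

Lemma generic_form_sqr i : f i * f i = 0.
Proof. by rewrite !generic_formE linear_form_sqr. Qed.

Lemma generic_form_anticomm i j : f i * f j = - (f j * f i).
Proof. by rewrite !generic_formE linear_form_anticomm. Qed.

Lemma generic_form_wedge i A : i \notin A ->
  exists b : bool, f i * fw A = (-1) ^+ b *: fw (i |: A).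
Proof.
move=> iA; have perm_A : perm_eq (i :: enum A) (enum (i |: A)).
  apply: uniq_perm; rewrite ?enum_uniq //= ?mem_enum ?iA ?enum_uniq // => j.
  by rewrite inE !mem_enum !inE.
have [b] := prod_perm (x := f) generic_form_anticomm perm_A.
by rewrite big_cons mulr_sign => bE; exists b; rewrite scaler_sign.
Qed.

Lemma generic_form_wedgeD1 i A : i \in A ->
  exists b : bool, fw A = (-1) ^+ b *: (f i * fw (A :\ i)).
Proof.
move=> iA; have [|b bE] := @generic_form_wedge i (A :\ i).
  by rewrite !inE eqxx.
by exists b; rewrite bE finset.setD1K // signrZK.
Qed.

Lemma generic_form_wedge0 i A : i \in A -> f i * fw A = 0.
Proof.
move=> iA; have -> : f i * fw A = \prod_(j <- i :: enum A) f j by rewrite big_cons.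
apply: (prod_dup0 (x := f) generic_form_sqr generic_form_anticomm).
by rewrite /= mem_enum iA.
Qed.

Lemma homogeneousM d e x y : homogeneous d x -> homogeneous e y ->
  homogeneous (d + e) (x * y).
Proof.
move=> hx hy F; rewrite /GRing.mul /= ffunE => xyF.
have /existsP[G /and3P[GF xG yG]] : [exists G : {set 'I_n},
    [&& G \subset F, x G != 0 & y (F :\: G) != 0]].
  apply: contraNT xyF => /existsPn no; rewrite big1 // => G GF.
  have := no G; rewrite GF /= negb_and !negbK => /orP[/eqP ->|/eqP ->];
  by rewrite ?mul0r ?mulr0.
by rewrite -(hx G xG) -(hy _ yG) cardsD (setIidPr GF) subnKC // subset_leq_card.
Qed.

Lemma wedge_homogeneous A : homogeneous #|A| (fw A).
Proof.
rewrite cardE /wedge; elim: (enum A) => [|i s IHs] /=.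
  rewrite big_nil => F; rewrite /GRing.one /= ffunE.
  by case: (F =P _) => [->|_]; rewrite ?cards0 ?eqxx.
rewrite big_cons -add1n; apply: homogeneousM => //.
by apply/homogeneous1P; exists (row i a); rewrite generic_formE.
Qed.

Definition degree_mx (d : nat) : 'M[K]_N :=
  diag_mx (\row_p (#|enum_val p : {set 'I_n}| == d)%:R).

Lemma mul_degree_mx l (X : 'M[K]_(l, N)) d i p :
  (X *m degree_mx d) i p = if #|enum_val p : {set 'I_n}| == d then X i p else 0.
Proof. by rewrite mul_mx_diag !mxE; case: eqP; rewrite ?mulr1 ?mulr0. Qed.

Lemma nonface_degree_mx d : (J *m degree_mx d <= J)%MS.
Proof.
apply/sub_nonface_mxP => p q qD; rewrite mul_degree_mx; case: ifP => // _.
by rewrite mxE; case: eqP => // ->; rewrite qD.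
Qed.

Lemma homogeneous_degree_mx d e x : homogeneous d x ->
  ext_row x *m degree_mx e = if d == e then ext_row x else 0.
Proof.
move=> hx; apply/rowP => p; rewrite mul_degree_mx mxE.
have [x0|/hx ->] := eqVneq (x (enum_val p)) 0.
  by case: ifP; case: ifP; rewrite ?mxE ?x0.
by case: ifP; rewrite !mxE.
Qed.

(** Projection to degree d fixes x, preserves J and kills the f_C of other degrees. *)
Lemma homogeneous_adds_family (P : pred {set 'I_n}) d x : homogeneous d x ->
  (ext_row x <= J + family_mx P fw)%MS ->
  (ext_row x <= J + family_mx (fun C => P C && (#|C| == d)) fw)%MS.
Proof.
move=> hx /(submxMr (degree_mx d)); rewrite (homogeneous_degree_mx _ hx) eqxx.
move=> /submx_trans; apply; rewrite addsmxMr addsmxS ?nonface_degree_mx //.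
apply/row_subP => p; rewrite row_mul rowK; case: ifP => [PC|_]; last by rewrite mul0mx sub0mx.
rewrite (homogeneous_degree_mx _ (@wedge_homogeneous _)); case: ifP => [Cd|_]; last exact: sub0mx.
by apply: sub_family_mx; rewrite PC.
Qed.

(* As the f_A and J_Delta are homogeneous, it does not matter whether all
   lexicographically smaller sets are allowed or only those of the same size. *)
Lemma in_smaller_spanP A : in_smaller_span a Delta A <->
  (ext_row (fw A) <= J + family_mx (fun B => lex_lt B A) fw)%MS.
Proof.
have mono B : generic_monomial a Delta B = face_class Delta (fw B) by [].
have sumE (c : {set 'I_n} -> K) :
    \sum_(B : {set 'I_n} | (#|B| == #|A|) && lex_lt B A)
       (c B)%:A *: generic_monomial a Delta B =
    face_class Delta (\sum_(B : {set 'I_n} | (#|B| == #|A|) && lex_lt B A) c B *: fw B).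
  rewrite (big_morph (face_class Delta) (face_classD Delta) (id1 := 0)); last exact: raddf0.
  by apply: eq_bigr => B _; rewrite mono -face_classZ -scalerAl mul1r.
split=> [[c] | ].
  rewrite sumE mono => /(face_class_eq cplx) sub.
  have : (ext_row (fw A) <= J + family_mx (fun B => (#|B| == #|A|) && lex_lt B A) fw)%MS.
    by apply/sub_adds_family_mx; exists c.
  move/submx_trans; apply.
  apply: addsmxS (submx_refl _) _; apply/family_mx_sub => C /andP[_ CA].
  exact: (@sub_family_mx _ _ (fun B => lex_lt B A)).
move/(homogeneous_adds_family (@wedge_homogeneous A))/sub_adds_family_mx => [c sub].
exists c; rewrite sumE mono; apply/(face_class_eq cplx).
by rewrite (eq_bigl (fun B => lex_lt B A && (#|B| == #|A|))) // => B; rewrite andbC.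
Qed.

Definition lex_new A := ~~ (ext_row (fw A) <= J + family_mx (fun B => lex_lt B A) fw)%MS.

(** If |A| exceeds the size of all faces, f_A lies in J for degree reasons; so every A passing the
    test has its size in the range of the union defining [ext_shift]. *)
Lemma ext_shiftE A : (A \in ext_shift a Delta) = lex_new A.
Proof.
apply/bigcupP/idP => [[i _] | newA].
  by rewrite inE => /andP[_ /asboolP nspan]; apply/negP => /in_smaller_spanP.
have le_max : (#|A| <= \max_(F in Delta) #|F|)%N.
  rewrite leqNgt; apply: contra newA => lt_max.
  apply: submx_trans (addsmxSl _ _); apply/sub_nonface_rowP => F FD.
  apply/eqP/negPn/negP => /wedge_homogeneous FA.
  have := @leq_bigmax_cond _ (fun F => F \in Delta) (fun F : {set 'I_n} => #|F|) F FD.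
  by rewrite FA leqNgt lt_max.
exists (Ordinal (le_max : (#|A| < _.+1)%N)) => //; rewrite inE eqxx /=.
by apply/asboolP => /in_smaller_spanP; apply/negP.
Qed.

End FormMonomials.

Lemma mxrank_adds_row (K : fieldType) N m (X : 'M[K]_(m, N)) (r : 'rV[K]_N) :
  \rank (X + r)%MS = (\rank X + ~~ (r <= X)%MS)%N.
Proof.
have [/addsmx_idPl -> | nrX] := boolP (r <= X)%MS; first by rewrite addn0.
have ltX : (X < X + r)%MS by rewrite ltmxE addsmxSl addsmx_sub submx_refl.
have := rank_ltmx ltX; have [le_add _] := mxrank_adds_leqif X r.
have := rank_leq_row r; lia.
Qed.

Section GreedyBasis.
Variables (K : fieldType) (n : nat) (a : 'M[K]_n) (Delta : {set {set 'I_n}}).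
Local Notation E := (extalg K n).
Local Notation N := #|{set 'I_n}|.
Local Notation J := (nonface_mx K Delta).
Local Notation f := (generic_form a).
Local Notation fw := (wedge (generic_form a)).
Local Notation shift := (ext_shift a Delta).
Implicit Types (A B C F : {set 'I_n}) (x y : E).
Local Notation fam P := (family_mx (fun A : {set 'I_n} => (A \in P)%bool) fw).
Hypothesis cplx : simplicial_complex Delta.

Lemma lex_max (P : {set {set 'I_n}}) : P != set0 ->
  exists2 A, A \in P & forall B, B \in P -> B != A -> lex_lt B A.
Proof.
case/set0Pn => A0 A0P.
(* The number of smaller sets increases strictly along the lexicographic order, so maximizing it
   finds the greatest member. *)
case: (@arg_maxnP _ A0 (fun A => A \in P) (fun A => #|[set B | lex_lt B A]%SET|) A0P).
move=> A AP max_A; exists A => // B BP neq.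
have /orP[//|AB] := lex_lt_total neq.
have : [set C | lex_lt C A]%SET \proper [set C | lex_lt C B]%SET.
  apply/properP; split; first by apply/subsetP => C; rewrite !inE => /lex_lt_trans; apply.
  by exists A; rewrite !inE ?lex_lt_irr.
by move/proper_card; rewrite ltnNge => /negP[]; exact: max_A.
Qed.

(** Removing the greatest member A of P leaves exactly the sets smaller than A, and putting f_A back
    raises the rank by one precisely when A is in the shifting. *)
Lemma rank_greedy (P : {set {set 'I_n}}) :
  (forall A B, A \in P -> lex_lt B A -> B \in P) ->
  \rank (J + fam P)%MS = (\rank J + #|shift :&: P|)%N.
Proof.
have [m] := ubnP #|P|; elim: m P => // m IHm P leP downP.
have [P0 | /lex_max[A AP max_A]] := eqVneq P set0.
  rewrite P0 finset.setI0 cards0 addn0; apply: eqmx_rank; rewrite addsmxSl andbT.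
  rewrite addsmx_sub submx_refl; apply/family_mx_sub => C.
  by rewrite inE.
have PE : P :\ A = [set B | lex_lt B A]%SET.
  apply/setP => B; rewrite !inE; apply/andP/idP => [[BA BP]|BA]; first exact: max_A.
  split; last exact: downP AP BA.
  by apply: contraTneq BA => ->; rewrite lex_lt_irr.
have IHP : \rank (J + family_mx (fun B => lex_lt B A) fw)%MS = (\rank J + #|shift :&: (P :\ A)|)%N.
  rewrite -IHm.
  - apply: eqmx_rank; apply/eqmxP; apply: adds_eqmx (eqmx_refl _) _.
    suff -> : family_mx (fun B => lex_lt B A) fw = fam (P :\ A) by [].
    by apply/row_matrixP => p; rewrite !rowK PE inE.
  - by rewrite (cardsD1 A) AP in leP.
  - by move=> B C; rewrite PE !inE => BA /lex_lt_trans; apply.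
have -> : \rank (J + fam P)%MS =
    \rank (J + family_mx (fun B => lex_lt B A) fw + ext_row (fw A))%MS.
  apply: eqmx_rank; apply/andP; split.
    rewrite addsmx_sub -addsmxA addsmxSl /=; apply/family_mx_sub => B BP.
    have [->|BA] := eqVneq B A; first by rewrite addsmxA addsmxSr.
    rewrite addsmxC -addsmxA; apply: submx_trans (addsmxSl _ _).
    by apply: (@sub_family_mx _ _ (fun B => lex_lt B A)); apply: max_A.
  rewrite !addsmx_sub addsmxSl /= ; apply/andP; split.
    apply: submx_trans (addsmxSr _ _); apply/family_mx_sub => B BA.
    by apply: (@sub_family_mx _ _ (fun B => B \in P)); apply: downP AP BA.
  apply: submx_trans (addsmxSr _ _).
  exact: (@sub_family_mx _ _ (fun B => B \in P)).
rewrite mxrank_adds_row IHP -addnA; congr (_ + _)%N.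
rewrite -/(lex_new a Delta A) -(ext_shiftE _ cplx) addnC [RHS](cardsD1 A) inE AP andbT.
by congr (_ + #|pred_of_set _|)%N; apply/setP => B; rewrite !inE; do !case: (_ \in _); case: eqP.
Qed.

Hypothesis unit_a : a \in unitmx.

(** The span of the f_A contains 1 and is stable under the f_i, hence under all linear forms because
    a is invertible; so it contains every e_F. *)
Lemma family_mx_full : row_full (family_mx predT fw).
Proof.
set U := family_mx predT fw.
have U1 : (ext_row 1 <= U)%MS.
  have -> : 1 = fw finset.set0 by rewrite /wedge enum_set0 big_nil.
  exact: (@sub_family_mx _ _ predT).
have Uf i : (U *m form_mx (row i a) <= U)%MS.
  apply/row_subP => p; rewrite row_mul rowK /= -ext_row_form_mul -generic_formE.
  have [iA | iA] := boolP (i \in (enum_val p : {set 'I_n})).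
    by rewrite generic_form_wedge0 // linear0 sub0mx.
  have [b ->] := generic_form_wedge a iA.
  by rewrite linearZ scalemx_sub // (@sub_family_mx _ _ predT).
have Uu u : (U *m form_mx u <= U)%MS.
  have -> : u = \sum_i (u *m invmx a) 0 i *: row i a.
    by rewrite -mulmx_sum_row mulmxKV.
  rewrite (linear_sum (@form_mx K n)) /= mulmx_sumr summx_sub // => i _.
  by rewrite linearZ /= -scalemxAr scalemx_sub.
rewrite -sub1mx; apply/row_subP => p; rewrite row1 -[p]enum_valK -ext_row_basis -wedge_gen.
rewrite /wedge; elim: (enum _) => [|i s IHs]; first by rewrite big_nil.
rewrite big_cons -linear_form_delta ext_row_form_mul.
exact: submx_trans (submxMr _ IHs) (Uu _).
Qed.

Lemma wedge_initial i B : i \in B ->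
  (ext_row (fw B) <= form_mx (row i a))%MS.
Proof.
move=> iB; have [b ->] := generic_form_wedgeD1 a iB.
by rewrite scalerAr generic_formE ext_row_form_mul submxMl.
Qed.

(** The f_A span E, and f_i f_A is 0 or, up to sign, the monomial of A with i added; conversely f_B
    is a multiple of f_i for each i in B. *)
Lemma form_ideal_top_rows r (le_rn : (r <= n)%N) :
  (form_ideal Delta (row_seq (top_rows le_rn a)) :=:
   J + fam [set B : {set 'I_n} | ~~ [disjoint B & initial_segment n r]]%SET)%MS.
Proof.
set P := [set B | _]%SET; rewrite /form_ideal /row_seq big_map big_enum /=.
apply/eqmxP/andP; split.
  rewrite addsmxS ?submx_refl //; apply/sumsmx_subP => j _.
  set i := widen_ord le_rn j; have -> : row j (top_rows le_rn a) = row i a.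
    by apply/rowP => k; rewrite !mxE.
  have i_r : i \in initial_segment n r by rewrite inE /= ltn_ord.
  rewrite -[form_mx _]mul1mx.
  apply: submx_trans (submxMr _ (_ : (1%:M <= family_mx predT fw)%MS)) _.
    by rewrite sub1mx family_mx_full.
  apply/row_subP => p; rewrite row_mul rowK /= -ext_row_form_mul -generic_formE.
  have [iA | iA] := boolP (i \in (enum_val p : {set 'I_n})).
    by rewrite generic_form_wedge0 // linear0 sub0mx.
  have [b ->] := generic_form_wedge a iA.
  rewrite linearZ scalemx_sub // (@sub_family_mx _ _ (fun B => B \in P)) // inE.
  by apply/negP => /disjointFr/(_ (setU11 _ _)); rewrite i_r.
rewrite addsmxS ?submx_refl //; apply/family_mx_sub => B.
rewrite inE -finset.setI_eq0 => /set0Pn[i]; rewrite !inE => /andP[iB ir].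
apply: submx_trans (wedge_initial iB) _.
apply: (sumsmx_sup (Ordinal ir)) => //.
suff -> : row (Ordinal ir) (top_rows le_rn a) = row i a by [].
by apply/rowP => k; rewrite !mxE; congr (a _ _); apply: val_inj.
Qed.

Lemma corank_top_rows_rank (P : {set {set 'I_n}}) :
  (forall A B, A \in P -> lex_lt B A -> B \in P) ->
  (N - \rank (J + fam P)%MS = #|Delta| - #|shift :&: P|)%N.
Proof.
move=> downP; rewrite (rank_greedy downP) rank_nonface_mx.
have : (#|Delta| <= N)%N by exact: max_card.
lia.
Qed.

Lemma card_ext_shift : #|shift| = #|Delta|.
Proof.
have := @rank_greedy finset.setT; rewrite finset.setIT => /(_ _) rk.
have := rk (fun _ _ _ _ => finset.in_setT _).
have -> : \rank (J + fam finset.setT)%MS = N.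
  apply/eqP; rewrite -[_ == _]/(row_full _) -sub1mx.
  apply: submx_trans (addsmxSr _ _); rewrite sub1mx.
  suff -> : fam finset.setT = family_mx predT fw by exact: family_mx_full.
  by apply/row_matrixP => p; rewrite !rowK inE.
rewrite rank_nonface_mx; have : (#|Delta| <= N)%N by exact: max_card.
lia.
Qed.

(** The sets meeting [r] are closed under passing to smaller sets by [lex_lt_initial], so
    [rank_greedy] applies to them. *)
Lemma corank_top_rows r (le_rn : (r <= n)%N) :
  corank Delta (row_seq (top_rows le_rn a)) =
  #|[set A in shift | [disjoint A & initial_segment n r]]%SET|.
Proof.
rewrite /corank form_ideal_top_rows corank_top_rows_rank; last first.
  move=> A B; rewrite !inE => nA BA; apply/negP => dB.
  by have := lex_lt_trans BA (lex_lt_initial nA dB); rewrite lex_lt_irr.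
rewrite -card_ext_shift.
rewrite -(cardsID [set B : {set 'I_n} | ~~ [disjoint B & initial_segment n r]]%SET).
by rewrite addKn; apply: eq_card => A; rewrite !inE negbK andbC.
Qed.

(** A relation expressing f of A minus x by smaller f_C becomes, after multiplication by f_x, one
    expressing f_A by smaller monomials, since adding x preserves the order. Elements are then
    removed one at a time. *)
Lemma ext_shift_complex : simplicial_complex shift.
Proof.
have del A (x : 'I_n) : x \in A -> A \in shift -> A :\ x \in shift.
  move=> xA; rewrite !(ext_shiftE _ cplx); apply: contra => /sub_adds_family_mx[c sub].
  have [b ->] := generic_form_wedgeD1 a xA; rewrite linearZ scalemx_sub //.
  rewrite -[fw (A :\ x)](subrK (\sum_(C | lex_lt C (A :\ x)) c C *: fw C)) mulrDr linearD.
  apply: addmx_sub_adds.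
    rewrite /= generic_formE ext_row_form_mul.
    exact: submx_trans (submxMr _ sub) (nonface_form_stable cplx _).
  rewrite mulr_sumr linear_sum summx_sub // => C CA.
  rewrite -scalerAr linearZ /= scalemx_sub //.
  have [xC|xC] := boolP (x \in C); first by rewrite generic_form_wedge0 // linear0 sub0mx.
  have [b' ->] := generic_form_wedge a xC.
  rewrite linearZ scalemx_sub //; apply: (@sub_family_mx _ _ (fun B => lex_lt B A)).
  apply: lex_lt_translate CA => i; rewrite !inE.
    by have [->|] := eqVneq i x; rewrite ?xA ?(negPf xC).
  by move=> -> _; rewrite orbT.
move=> A B; have [m] := ubnP #|A :\: B|; elim: m A => // m IHm A leAB A_shift BA.
have [/eqP|/set0Pn[x]] := eqVneq (A :\: B) set0.
  by rewrite finset.setD_eq0 => AB; have /eqP -> : B == A by rewrite eqEsubset BA.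
rewrite inE => /andP[xB xA]; apply: (IHm (A :\ x)).
- rewrite ltnS in leAB; apply: leq_trans leAB; apply: proper_card; apply/properP; split.
    by apply: finset.setSD; exact: subD1set.
  by exists x; rewrite !inE ?eqxx ?xB.
- exact: del.
by rewrite subsetD1 BA.
Qed.

(** If the shifting had no member of the top size m, lexicographic induction would put every f_A
    with |A| = m into J, and with them e_F for a face F of size m. *)
Lemma ext_shift_max : \max_(A in shift) #|A| = \max_(F in Delta) #|F|.
Proof.
set m := \max_(F in Delta) _; apply/eqP; rewrite eqn_leq; apply/andP; split.
  apply/bigmax_leqP => A /bigcupP[i _]; rewrite inE => /andP[/eqP -> _].
  by rewrite -ltnS ltn_ord.
have [D0 | D0] := posnP #|Delta|.
  by rewrite /m big_pred0 // => F; rewrite (card0_eq D0).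
have [F0 F0D mE] : {F0 | F0 \in Delta & m = #|F0|} by apply: eq_bigmax_cond.
have [/existsP[A /andP[A_shift /eqP <-]] | /existsPn no] :=
    boolP [exists A : {set 'I_n}, (A \in shift) && (#|A| == m)].
  exact: (@leq_bigmax_cond _ (fun A => A \in shift) (fun A : {set 'I_n} => #|A|)).
have fwJ A : #|A| = m -> (ext_row (fw A) <= J)%MS.
  have [k] := ubnP #|[set B | lex_lt B A]%SET|; elim: k A => // k IHk A leA Am.
  have := no A; rewrite Am eqxx andbT (ext_shiftE _ cplx) negbK.
  move=> /(homogeneous_adds_family (@wedge_homogeneous _ _ a A))/submx_trans; apply.
  rewrite addsmx_sub submx_refl; apply/family_mx_sub => C /andP[CA /eqP Cm].
  apply: IHk; last by rewrite Cm.
  rewrite ltnS in leA; apply: leq_trans leA; apply: proper_card; apply/properP; split.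
    by apply/subsetP => B; rewrite !inE => /lex_lt_trans; apply.
  by exists C; rewrite !inE ?lex_lt_irr.
have eF0 : (ext_row (ext_basis K F0) <= J + family_mx predT fw)%MS.
  by apply: submx_trans (addsmxSr _ _); rewrite submx_full // family_mx_full.
have hF0 : homogeneous #|F0| (ext_basis K F0).
  by move=> F; rewrite ffunE; case: (F =P F0) => [->|]; rewrite ?eqxx.
have : (ext_row (ext_basis K F0) <= J)%MS.
  apply: submx_trans (homogeneous_adds_family hF0 eF0) _.
  by rewrite addsmx_sub submx_refl; apply/family_mx_sub => C /eqP CF; apply: fwJ; rewrite mE.
move/sub_nonface_rowP/(_ _ F0D)/eqP; rewrite ffunE eqxx.
by rewrite (negPf (oner_neq0 K)).
Qed.

End GreedyBasis.

(** * The exterior shifting is shifted *)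

Lemma addrBB_cancel (V : zmodType) (x y p q : V) : x + y - (p + q) - (x - p) = y - q.
Proof. by rewrite opprD addrACA [x - p + _]addrC addrK. Qed.

(** A maximal minor of X + t Y that is nonzero at t = 0 is a nonzero polynomial in t, so over an
    infinite field it is nonzero at some t other than 0. *)
Lemma rank_perturb (K : fieldType) m p (X Y : 'M[K]_(m, p)) :
  (forall k, exists2 s : seq K, uniq s & size s = k) ->
  exists2 t, t != 0 & (\rank X <= \rank (X + t *: Y)%R)%N.
Proof.
move=> infK; pose A : 'M[{poly K}]_(m, p) := map_mx polyC X + 'X *: map_mx polyC Y.
pose psi (t : {t : K | t != 0}) : {rmorphism {poly K} -> K} := horner_eval (val t).
have AE t : map_mx (horner_eval t) A = X + t *: Y.
  by apply/matrixP => i j; rewrite !mxE /horner_eval !hornerE.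
have [|[t t0]] := @rank_evaluation _ K K (horner_eval 0) _ psi m p A.
  move=> q q0; have [s us ss] := infK (size q).+1.
  have /hasP[t ts /andP[qt t0]] : has (fun t => (q.[t] != 0) && (t != 0)) s.
    rewrite -[has _ _]negbK -all_predC; apply/negP => /allP all_root.
    (* The factor X makes 0 a root as well, so that avoiding the roots of q X also ensures t !=
       0. *)
    have : (size s < size (q * 'X)%R)%N.
      apply: max_poly_roots => //; first by rewrite mulf_neq0 ?polyX_eq0.
      apply/allP => t /all_root /=; rewrite negb_and !negbK /root hornerM hornerX.
      by rewrite mulf_eq0.
    by rewrite size_mulX // ss ltnn.
  by exists (exist _ t t0).
move=> le_rank; exists t => //; apply: leq_trans (leq_trans le_rank _).
  by rewrite (AE 0) scale0r addr0.
by rewrite (AE t).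
Qed.

(** * Form monomials under a change of the matrix of forms *)

Section FormMonomialMatrices.
Variables (n : nat) (Delta : {set {set 'I_n}}).
Local Notation N := #|{set 'I_n}|.

(** [extalg] has coefficients in a field; over polynomial rings the product of the forms is obtained
    by letting their matrices act on the row of 1. *)
Definition monomial_row (R : comPzRingType) (g : 'M[R]_n) (s : seq 'I_n) : 'rV[R]_N :=
  foldr (fun i r => r *m form_mx (row i g)) (delta_mx 0 (enum_rank finset.set0)) s.

Lemma map_monomial_row (R S : comPzRingType) (phi : {rmorphism R -> S})
    (g : 'M[R]_n) s :
  map_mx phi (monomial_row g s) = monomial_row (map_mx phi g) s.
Proof.
elim: s => [|i s IHs] /=; first exact: map_delta_mx.
by rewrite map_mxM IHs map_form_mx map_row.
Qed.

Lemma ext_row_wedge (K : fieldType) (b : 'M[K]_n) A :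
  ext_row (wedge (generic_form b) A) = monomial_row b (enum A).
Proof.
rewrite /wedge; elim: (enum A) => [|i s IHs] /=.
  rewrite big_nil -ext_row_basis -wedge_gen /wedge.
  by rewrite enum_set0 big_nil.
by rewrite big_cons generic_formE ext_row_form_mul IHs.
Qed.

Definition monomial_stack (R : comPzRingType) (g : 'M[R]_n) (P : pred {set 'I_n}) :
    'M[R]_(N + N, N) :=
  col_mx (nonface_mx R Delta)
    (\matrix_(p < N) if P (enum_val p) then monomial_row g (enum (enum_val p : {set 'I_n})) else 0).

Lemma map_monomial_stack (R S : comPzRingType) (phi : {rmorphism R -> S})
    (g : 'M[R]_n) P :
  map_mx phi (monomial_stack g P) = monomial_stack (map_mx phi g) P.
Proof.
rewrite /monomial_stack map_col_mx map_nonface_mx; congr col_mx.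
apply/row_matrixP => p; rewrite -map_row !rowK; case: ifP => _; last exact: map_mx0.
exact: map_monomial_row.
Qed.

Lemma rank_monomial_stack (K : fieldType) (b : 'M[K]_n) P :
  \rank (monomial_stack b P) =
  \rank (nonface_mx K Delta + family_mx P (wedge (generic_form b)))%MS.
Proof.
rewrite addsmxE; congr (\rank (col_mx _ _)).
by apply/row_matrixP => p; rewrite !rowK ext_row_wedge.
Qed.

End FormMonomialMatrices.

Section Perturbation.
Variables (K : fieldType) (n : nat) (a : 'M[K]_n) (i j : 'I_n).
Local Notation E := (extalg K n).
Local Notation f := (generic_form a).
Implicit Types (A B C : {set 'I_n}) (t : K).

Definition perturbed t : 'M[K]_n := a + t *: (delta_mx i j *m a).

Definition replaced_form (k : 'I_n) : E := if k == i then f j else f k.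

Definition wedge_derivative C : E := if i \in C then wedge replaced_form C else 0.

Lemma generic_form_perturbed t k :
  generic_form (perturbed t) k = f k + (if k == i then t *: f j else 0).
Proof.
rewrite !generic_formE /linear_form -[RHS]/(_ + _).
have -> : row k (perturbed t) = row k a + (if k == i then t *: row j a else 0).
  apply/rowP => l; rewrite !mxE (bigD1 j) //= big1 => [|m mj]; last first.
    by rewrite mxE (negPf mj) andbF mul0r.
  rewrite mxE eqxx andbT addr0; case: eqP => _; rewrite !mxE ?mul1r //.
  by rewrite mul0r mulr0.
case: eqP => _; rewrite ?addr0 // scaler_sumr -big_split /=.
by apply: eq_bigr => l _; rewrite !mxE scalerDl scalerA.
Qed.

(** The factor f_i occurs at most once, so the product is affine in t, with slope obtained by
    writing f_j in its place. *)
Lemma wedge_perturbed t C :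
  wedge (generic_form (perturbed t)) C = wedge f C + t *: wedge_derivative C.
Proof.
rewrite /wedge_derivative -(mem_enum C) /wedge.
elim: (enum C) (enum_uniq C) => [|k s IHs] /=; first by rewrite !big_nil scaler0 addr0.
move=> /andP[ks /IHs {}IHs]; rewrite !big_cons IHs generic_form_perturbed inE (eq_sym i).
rewrite {2}/replaced_form; have [ki|ki] := eqVneq k i.
  rewrite ki in ks *; rewrite (negPf ks) scaler0 addr0 mulrDl scalerAl /=.
  congr (_ + _ * _); apply: eq_big_seq => l ls; rewrite /replaced_form.
  by case: eqP => // li; rewrite -li ls in ks.
rewrite /= addr0 mulrDr -scalerAr; congr (_ + _ *: _).
by case: ifP; rewrite ?mulr0.
Qed.

Lemma wedge_replaced C :
  wedge replaced_form C = \prod_(k <- [seq if k == i then j else k | k <- enum C]) f k.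
Proof. by rewrite big_map; apply: eq_bigr => k _; rewrite /replaced_form; case: ifP. Qed.

Lemma perm_replaced C : i \in C ->
  perm_eq [seq if k == i then j else k | k <- enum C] (j :: enum (C :\ i)).
Proof.
move=> iC; have eC : perm_eq (enum C) (i :: enum (C :\ i)).
  apply: uniq_perm; rewrite ?enum_uniq //= ?mem_enum ?inE ?eqxx ?enum_uniq // => k.
  by rewrite inE !mem_enum !inE; case: eqP => // ->.
apply: perm_trans (perm_map _ eC) _; rewrite /= eqxx map_id_in // => k.
by rewrite mem_enum !inE => /andP[/negPf ->].
Qed.

Lemma wedge_derivative_dup C : j \in C -> i != j -> wedge_derivative C = 0.
Proof.
move=> jC ij; rewrite /wedge_derivative; case: ifP => // iC; rewrite wedge_replaced.
apply: (prod_dup0 (x := f) (generic_form_sqr a) (generic_form_anticomm a)).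
by rewrite (perm_uniq (perm_replaced iC)) /= mem_enum !inE eq_sym ij jC.
Qed.

Lemma wedge_derivativeE C : i \in C -> j \notin C ->
  exists b : bool, wedge_derivative C = (-1) ^+ b *: wedge f (j |: C :\ i).
Proof.
move=> iC jC; rewrite /wedge_derivative iC wedge_replaced.
have perm_s : perm_eq [seq if k == i then j else k | k <- enum C] (enum (j |: C :\ i)).
  apply: perm_trans (perm_replaced iC) _.
  apply: uniq_perm; rewrite ?enum_uniq //= ?mem_enum ?inE ?(negPf jC) ?andbF ?enum_uniq // => k.
  by rewrite inE !mem_enum !inE.
have [b ->] := prod_perm (x := f) (generic_form_anticomm a) perm_s.
by exists b; rewrite mulr_sign scaler_sign.
Qed.

End Perturbation.

Section Shifted.
Variables (K K' : fieldType) (iota : {rmorphism K -> K'}) (n : nat).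
Variables (a : 'M[K']_n) (Delta : {set {set 'I_n}}).
Hypothesis indep : alg_independent iota a.
Hypothesis infK' : forall k, exists2 s : seq K', uniq s & size s = k.
Hypothesis cplx : simplicial_complex Delta.
Local Notation E := (extalg K' n).
Local Notation J := (nonface_mx K' Delta).
Local Notation f := (generic_form a).
Local Notation fw := (wedge (generic_form a)).
Local Notation N := #|{set 'I_n}|.
Implicit Types (A B C : {set 'I_n}).

(** The generic rank is at least the rank at the identity matrix. *)
Lemma generic_unitmx : a \in unitmx.
Proof.
have := generic_rank indep iota 1%:M (entry_mx K n).
rewrite !map_entry_mx mxrank1 => le_n; rewrite -row_full_unit.
by rewrite /row_full eqn_leq rank_leq_col le_n.
Qed.

Lemma rank_generic_family (b : 'M[K']_n) (P : pred {set 'I_n}) :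
  (\rank (J + family_mx P (wedge (generic_form b)))%MS <=
   \rank (J + family_mx P fw)%MS)%N.
Proof.
have := generic_rank indep iota b (monomial_stack Delta (entry_mx K n) P).
by rewrite !map_monomial_stack !map_entry_mx !rank_monomial_stack.
Qed.

(* Modulo J_Delta and by genericity, replacing f_i by f_i + t f_j does not
   increase the dimension of the span of the f_C with C <= B, where
   B = A - {j} + {i}. If f_B depends on the smaller f_C, then, for t -> 0, so does
   the t-derivative of that relation, in which f_A is the leading term. *)
Lemma ext_shift_shifted A (i j : 'I_n) : A \in ext_shift a Delta ->
  (i < j)%N -> j \in A -> i \notin A -> i |: A :\ j \in ext_shift a Delta.
Proof.
rewrite !(ext_shiftE _ cplx) => newA ij jA iA; set B := i |: A :\ j.
have neq_ij : i != j by rewrite neq_ltn ij.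
apply: contra newA => /sub_adds_family_mx[c Bsub].
pose h := wedge_derivative a i j.
pose Q := [pred C | lex_lt C B].
pose S := (J + family_mx Q fw)%MS.
pose w := h B - \sum_(C | Q C) c C *: h C.
have BA : lex_lt B A.
  apply/lex_ltP; exists i; rewrite !inE eqxx (negPf iA); split=> // k ki.
  rewrite !inE; have -> : k == i = false by apply: contraTF ki => /eqP ->; rewrite ltnn.
  by have -> : k == j = false by apply: contraTF ki => /eqP ->; rewrite -leqNgt ltnW.
have jB : j \notin B by rewrite !inE eqxx eq_sym (negPf neq_ij).
have iB : i \in B by rewrite !inE eqxx.
have BE : j |: B :\ i = A.
  apply/setP => k; rewrite !inE; have [->|kj] := eqVneq k j; first by rewrite jA.
  by have [->|] := eqVneq k i; rewrite ?(negPf iA).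
have S_small : (S <= J + family_mx (fun C => lex_lt C A) fw)%MS.
  rewrite addsmxS ?submx_refl //; apply/family_mx_sub => C CB.
  by apply: (@sub_family_mx _ _ (fun C => lex_lt C A)); apply: lex_lt_trans BA.
have wS : (ext_row w <= S)%MS.
  (* X spans S together with w. For a suitable t the rank does not drop in X + t Y, whose rows lie
     in the span of J and the perturbed f_C with C = B or C smaller than B. By genericity that span
     is no larger than the unperturbed one, which is S. So w adds nothing to S. *)
  pose X := col_mx J (col_mx (family_mx Q fw) (ext_row w)).
  pose Y := col_mx 0 (col_mx (family_mx Q h) 0) : 'M[K']_(N + (N + 1), N).
  have [t t0 le_rank] := rank_perturb X Y infK'.
  pose fwt := wedge (generic_form (perturbed a i j t)).
  have fwtE C : fwt C = fw C + t *: h C by exact: wedge_perturbed.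
  pose Q' := [pred C | Q C || (C == B)].
  have Q'_sub C : Q' C -> (ext_row (fwt C) <= J + family_mx Q' fwt)%MS.
    by move=> QC; apply: submx_trans (addsmxSr _ _); apply: sub_family_mx QC.
  have Xt_sub : ((X + t *: Y)%R <= J + family_mx Q' fwt)%MS.
    rewrite scale_col_mx add_col_mx scaler0 addr0 scale_col_mx add_col_mx scaler0 addr0.
    rewrite !col_mx_sub addsmxSl /=; apply/andP; split.
      apply/row_subP => p; have -> : row p (family_mx Q fw + t *: family_mx Q h)%R =
          row p (family_mx Q fwt).
        rewrite linearD linearZ /= !rowK; case: ifP => _; last by rewrite scaler0 addr0.
        by rewrite fwtE linearD linearZ.
      by rewrite rowK; case: ifP => QC; rewrite ?sub0mx // Q'_sub //; apply/orP; left.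
    (* w is the difference quotient of the relation for f_B between the parameters t and 0. *)
    have -> : w = t^-1 *: (fwt B - \sum_(C | Q C) c C *: fwt C
                          - (fw B - \sum_(C | Q C) c C *: fw C)).
      have -> : \sum_(C | Q C) c C *: fwt C =
          \sum_(C | Q C) c C *: fw C + t *: \sum_(C | Q C) c C *: h C.
        rewrite scaler_sumr -big_split; apply: eq_bigr => C _ /=.
        by rewrite fwtE scalerDr !scalerA mulrC.
      have -> : fwt B - (\sum_(C | Q C) c C *: fw C + t *: \sum_(C | Q C) c C *: h C) -
          (fw B - \sum_(C | Q C) c C *: fw C) = t *: w.
        by rewrite fwtE /w scalerBr; exact: addrBB_cancel.
      by rewrite scalerA mulVf // scale1r.
    rewrite linearZ scalemx_sub // linearB /= addmx_sub //.
      rewrite linearB /= addmx_sub ?Q'_sub ?inE ?eqxx ?orbT //.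
      rewrite -scaleN1r scalemx_sub // linear_sum summx_sub // => C QC.
      by rewrite linearZ scalemx_sub // Q'_sub //; apply/orP; left.
    by rewrite -scaleN1r scalemx_sub // (submx_trans Bsub) // addsmxSl.
  have rank_S : (\rank (J + family_mx Q' fw)%MS <= \rank S)%N.
    apply: mxrankS; rewrite addsmx_sub addsmxSl /=; apply/family_mx_sub => C /orP[QC|/eqP ->].
      by apply: submx_trans (addsmxSr _ _); apply: sub_family_mx QC.
    by apply/sub_adds_family_mx; exists c.
  have SX : (S <= X)%MS.
    by rewrite /X -addsmxE addsmxS ?submx_refl // -addsmxE addsmxSl.
  have /submx_trans : (ext_row w <= X)%MS.
    by rewrite /X -addsmxE; apply: submx_trans (addsmxSr _ _); rewrite -addsmxE addsmxSr.
  apply; rewrite -(geq_leqif (mxrank_leqif_sup SX)).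
  apply: leq_trans le_rank _; apply: leq_trans (mxrankS Xt_sub) _.
  exact: leq_trans (rank_generic_family _ _) rank_S.
have [b hB] := wedge_derivativeE a iB jB.
rewrite BE in hB.
(* The derivative of f_B is f_A up to sign; those of the smaller f_C are zero or, up to sign,
   monomials of sets smaller than A. *)
have -> : fw A = (-1) ^+ b *: (w + \sum_(C | Q C) c C *: h C).
  by rewrite subrK /h hB scalerA -signr_addb addbb scale1r.
rewrite linearZ scalemx_sub // linearD addmx_sub ?(submx_trans wS) //.
rewrite linear_sum summx_sub // => C CB; rewrite linearZ scalemx_sub //.
have [jC|jC] := boolP (j \in C); first by rewrite /h wedge_derivative_dup // linear0 sub0mx.
have [iC|iC] := boolP (i \in C); last first.
  by rewrite /h /wedge_derivative (negPf iC) linear0 sub0mx.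
have [b' hC] := wedge_derivativeE a iC jC.
rewrite /h hC linearZ scalemx_sub //; apply: submx_trans (addsmxSr _ _).
apply: (@sub_family_mx _ _ (fun C => lex_lt C A)).
apply: lex_lt_translate CB => k; rewrite /B !inE.
  have [->|kj] := eqVneq k j; first by rewrite jA (negPf jC) eq_sym (negPf neq_ij).
  by have [->|ki] := eqVneq k i; rewrite ?iC ?(negPf iA).
by move=> kC; rewrite negb_or => /andP[ki _]; rewrite ki kC orbT.
Qed.

End Shifted.

(** * Reduced homology *)

Section Homology.
Variables (K : fieldType) (n : nat).
Local Notation N := #|{set 'I_n}|.
Implicit Types (Gamma : {set {set 'I_n}}) (c z w : {ffun {set 'I_n} -> K})
  (A F G H : {set 'I_n}).

Definition chain_col c : 'cV[K]_N := \col_q c (enum_val q).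

Lemma inversions1 (i : 'I_n) F :
  inversions [set i]%SET F = #|[set j in F | (j < i)%N]%SET|.
Proof.
rewrite inversionsE big_set1 -sum1_card [RHS]big_mkcond [LHS]big_mkcond /=.
by apply: eq_bigr => j _; rewrite inE; case: (j \in F); case: ltnP.
Qed.

(* The boundary is the transpose of the multiplication by e_1 + ... + e_n. *)
Lemma chain_col_boundary c :
  chain_col (boundary c) = form_mx (const_mx 1) *m chain_col c.
Proof.
apply/colP => p; rewrite !mxE ffunE.
under [RHS]eq_bigr => q _ do rewrite summxE mulr_suml.
rewrite exchange_big [LHS]big_mkcond; apply: eq_bigr => i _ /=.
rewrite (bigD1 (enum_rank (i |: enum_val p))) //= big1 => [|q neq].
  rewrite !mxE /= !enum_rankK eqxx andbT mul1r addr0 inversions1.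
  by case: ifP => _; rewrite ?mul0r.
rewrite !mxE /= mul1r; case: ifP => [/andP[_ /eqP qE]|_]; last by rewrite mul0r.
by rewrite -qE enum_valK eqxx in neq.
Qed.

Lemma boundaryK c : boundary (boundary c) = 0.
Proof.
have : chain_col (boundary (boundary c)) = 0.
  by rewrite !chain_col_boundary mulmxA form_mx_sqr mul0mx.
move/colP => c0; apply/ffunP => F; have := c0 (enum_rank F).
by rewrite !mxE enum_rankK => ->; rewrite ffunE.
Qed.

Definition facet_chain A : {ffun {set 'I_n} -> K} := [ffun F => (F == A)%:R].

(** No face contains A properly, so every boundary has coefficient 0 at A, unlike z. *)
Lemma nonacyclic_facet Gamma A z : A \in Gamma ->
  (forall x, x \notin A -> x |: A \notin Gamma) ->
  is_chain Gamma (#|A|%:Z - 1) z -> boundary z = 0 -> z A != 0 ->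
  nonacyclic K Gamma.
Proof.
move=> AG facet zG z0 zA; exists (#|A|%:Z - 1); split.
  have : (#|A| <= \max_(F in Gamma) #|F|)%N.
    exact: (@leq_bigmax_cond _ (fun F => F \in Gamma) (fun F : {set 'I_n} => #|F|)).
  by rewrite /complex_dim; lia.
exists z; split=> // -[w wG zE]; case/eqP: zA; rewrite zE ffunE big1 // => x xA.
have [->|/wG[xAG _]] := eqVneq (w (x |: A)) 0; first by rewrite mulr0.
by rewrite (negPf (facet x xA)) in xAG.
Qed.

Lemma nonacyclic_set0 : nonacyclic K [set finset.set0 : {set 'I_n}]%SET.
Proof.
apply: (@nonacyclic_facet _ finset.set0 (facet_chain finset.set0)).
- exact: finset.set11.
- move=> x _; rewrite inE; apply/negP => /eqP/setP/(_ x).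
  by rewrite !inE eqxx.
- move=> F; rewrite ffunE; case: (F =P _) => [-> _|_]; last by rewrite eqxx.
  by rewrite finset.set11 cards0.
- apply/ffunP => F; rewrite !ffunE big1 // => x _; rewrite ffunE.
  case: (_ =P _) => [/setP/(_ x)|_]; last by rewrite mulr0.
  by rewrite !inE eqxx.
by rewrite ffunE eqxx oner_neq0.
Qed.

(* The boundary of the missing face r |: A is a cycle, and A is a facet. *)
Lemma nonacyclic_shifted Gamma (r : 'I_n) A : A \in Gamma -> r \notin A ->
  r |: A \notin Gamma ->
  (forall F x, F \in Gamma -> x \in F -> r \notin F -> r |: F :\ x \in Gamma) ->
  nonacyclic K Gamma.
Proof.
move=> AG rA rAG shifted.
apply: (@nonacyclic_facet _ A (boundary (facet_chain (r |: A)))) => //.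
- move=> x xA; apply/negP => xAG; have [xr|xr] := eqVneq x r.
    by rewrite -xr xAG in rAG.
  (* Exchanging x for r in a face x + A would make r + A a face. *)
  case/negP: rAG; have -> : A = (x |: A) :\ x by rewrite setU1K.
  by apply: shifted; rewrite ?inE ?eqxx // eq_sym negb_or xr.
- move=> F; rewrite ffunE => zF.
  have /existsP[i /andP[iF /eqP iE]] : [exists i, (i \notin F) && (i |: F == r |: A)].
    apply: contraNT zF => /existsPn no; rewrite big1 // => i iF.
    by have := no i; rewrite iF ffunE => /= /negPf ->; rewrite mulr0.
  have cardF : #|F| = #|A|.
    by have := cardsU1 i F; rewrite iE cardsU1 iF rA => /addnI.
  split; last by rewrite cardF; lia.
  have FE : F = (r |: A) :\ i by rewrite -iE setU1K.
  have [ir|ir] := eqVneq i r; first by rewrite FE ir setU1K.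
  have iA : i \in A by have := setU11 i F; rewrite iE !inE (negPf ir).
  (* The remaining faces in the boundary of r + A arise from A by exchanging some i for r. *)
  have -> : F = r |: A :\ i.
    rewrite FE; apply/setP => j; rewrite !inE.
    by have [->|] := eqVneq j r; rewrite ?andbT //= eq_sym ir.
  exact: shifted.
- exact: boundaryK.
rewrite ffunE (bigD1 r) //= big1 => [|i /andP[iA ir]].
  by rewrite ffunE eqxx mulr1 addr0 signr_eq0.
rewrite ffunE; case: (_ =P _) => [/setP/(_ i)|_]; last by rewrite mulr0.
by rewrite !inE eqxx (negPf ir) (negPf iA).
Qed.

(** A cycle z is the boundary of the cone with apex r over the part of z avoiding r. As r is the
    least vertex, it comes first in the orientation and carries the sign +1. *)
Lemma cone_acyclic Gamma (r : 'I_n) :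
  (forall F, F \in Gamma -> r \notin F -> r |: F \in Gamma) ->
  (forall F x, F \in Gamma -> x \in F -> (r <= x)%N) ->
  ~ nonacyclic K Gamma.
Proof.
move=> cone min_r [d [_ [z [zG z0 nb]]]]; apply: nb.
pose w : {ffun {set 'I_n} -> K} := [ffun H : {set 'I_n} => if r \in H then z (H :\ r) else 0].
have sgn_r F : F \in Gamma -> [set j in F | (j < r)%N]%SET = finset.set0.
  move=> FG; apply/setP => j; rewrite !inE; apply/negP => /andP[jF].
  by rewrite ltnNge (min_r _ _ FG jF).
exists w => [H|].
  rewrite ffunE; case: ifP => [rH /zG[HG Hd]|_]; last by rewrite eqxx.
  split; first by rewrite -(finset.setD1K rH) cone // !inE eqxx.
  by rewrite (cardsD1 r) rH PoszD Hd addrC.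
apply/ffunP => G; rewrite ffunE.
have [rG|rG] := boolP (r \in G); last first.
  rewrite (bigD1 r) //= big1 ?addr0 => [|i /andP[iG ir]]; last first.
    by rewrite ffunE !inE (negPf rG) orbF eq_sym (negPf ir) mulr0.
  rewrite ffunE setU11 setU1K //.
  have [->|/zG[GG _]] := eqVneq (z G) 0; first by rewrite mulr0.
  by rewrite (sgn_r G) // cards0 mul1r.
(* For G containing r, the vanishing of the boundary of z at G - r expresses z at G by the values of
   w at the sets i + G. The vertex r < i accounts for the change of sign. *)
have := congr1 (fun c : {ffun {set 'I_n} -> K} => c (G :\ r)) z0.
rewrite !ffunE (bigD1 r) /=; last by rewrite !inE eqxx.
rewrite finset.setD1K // => /eqP; rewrite addr_eq0 => /eqP zE.
have -> : z G = (-1) ^+ #|[set j in G :\ r | (j < r)%N]%SET| * z G.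
  have [->|/zG[GG _]] := eqVneq (z G) 0; first by rewrite mulr0.
  suff -> : [set j in G :\ r | (j < r)%N]%SET = finset.set0 by rewrite cards0 mul1r.
  apply/setP => j; rewrite !inE; apply/negP => /andP[/andP[_ jG]].
  by rewrite ltnNge (min_r _ _ GG jG).
rewrite zE -sumrN; apply: eq_big => [i|i iG].
  by rewrite !inE; case: (eqVneq i r) => [->|]; rewrite ?rG ?andbT //= ?andbF.
have /andP[_ ir] := iG.
rewrite ffunE !inE rG orbT.
have -> : (i |: G) :\ r = i |: G :\ r.
  by apply/setP => j; rewrite !inE; have [->|] := eqVneq j i; rewrite ?ir.
have [->|/zG[iGG _]] := eqVneq (z (i |: G :\ r)) 0; first by rewrite !mulr0 oppr0.
have ri : (r < i)%N by rewrite ltn_neqAle eq_sym ir (min_r _ _ iGG) // setU11.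
rewrite -mulNr; congr (_ * _).
rewrite [in RHS](cardsD1 r) inE rG ri /= add1n exprS mulN1r; congr (- (-1) ^+ #|pred_of_set _|).
by apply/setP => j; rewrite !inE andbA.
Qed.

End Homology.

(** * Joins with a simplex *)

Section Joins.
Variable n : nat.
Implicit Types (Delta Gamma : {set {set 'I_n}}) (A F G : {set 'I_n}).

(** Applied to Delta^e, this is the complex Gamma_r. *)
Definition free_part Delta r : {set {set 'I_n}} :=
  [set A in Delta | [disjoint A & initial_segment n r]]%SET.

Lemma card_initial_segment r : (r <= n)%N -> #|initial_segment n r| = r.
Proof.
move=> le_rn; have inj : injective (widen_ord le_rn) by move=> i j [] /val_inj.
rewrite -[RHS]card_ord -(card_imset _ inj).
apply: eq_card => i; rewrite inE; apply/idP/imsetP => [ir | [j _ ->]]; last exact: (ltn_ord j).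
by exists (Ordinal ir) => //; apply: val_inj.
Qed.

Lemma card_simplex r : (r <= n)%N -> #|simplex n r| = (2 ^ r)%N.
Proof. by move=> le_rn; rewrite card_powerset card_initial_segment. Qed.

Lemma mem_simplex r F : (F \in simplex n r) = (F \subset initial_segment n r).
Proof. exact: powersetE. Qed.

Lemma free_part_complex Delta r : simplicial_complex Delta ->
  simplicial_complex (free_part Delta r).
Proof.
move=> cplx F G; rewrite !inE => /andP[FD dF] GF.
by rewrite (cplx _ _ FD GF) (disjointWl GF).
Qed.

Lemma disjoint_join_inj r (F F' G G' : {set 'I_n}) :
  F \subset initial_segment n r -> F' \subset initial_segment n r ->
  [disjoint G & initial_segment n r] -> [disjoint G' & initial_segment n r] ->
  F :|: G = F' :|: G' -> F = F' /\ G = G'.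
Proof.
have split_join A (B : {set 'I_n}) :
    A \subset initial_segment n r -> [disjoint B & initial_segment n r] ->
    (A :|: B) :&: initial_segment n r = A /\ (A :|: B) :\: initial_segment n r = B.
  move=> Ar; rewrite -finset.setI_eq0 => /eqP Br.
  rewrite finset.setIUl finset.setDUl Br finset.setU0 (finset.setIidPl Ar); split=> //.
  have -> : A :\: initial_segment n r = finset.set0 by apply/eqP; rewrite finset.setD_eq0.
  by rewrite finset.set0U; apply/finset.setDidPl; rewrite -finset.setI_eq0 Br.
move=> Fr F'r Gr G'r e; have [FE GE] := split_join F G Fr Gr.
have [F'E G'E] := split_join F' G' F'r G'r.
by split; [rewrite -[LHS]FE e | rewrite -[LHS]GE e].
Qed.

Lemma card_simplicial_join r Gamma : (r <= n)%N ->
  (forall G, G \in Gamma -> [disjoint G & initial_segment n r]) ->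
  #|simplicial_join (simplex n r) Gamma| = (2 ^ r * #|Gamma|)%N.
Proof.
move=> le_rn disj; rewrite -card_simplex // -cardsX /simplicial_join curry_imset2X.
rewrite card_in_imset // => -[F G] [F' G'] /=; rewrite !finset.in_setX /= !mem_simplex.
move=> /andP[Fr Gr] /andP[F'r G'r] e.
by have [-> ->] := disjoint_join_inj Fr F'r (disj _ Gr) (disj _ G'r) e.
Qed.

(** This inclusion reduces equality with the join to a count of faces, made in
    [shift_regular_join]. *)
Lemma sub_join_free_part Delta r : simplicial_complex Delta ->
  Delta \subset simplicial_join (simplex n r) (free_part Delta r).
Proof.
move=> cplx; apply/subsetP => A AD.
apply/imset2P; exists (A :&: initial_segment n r) (A :\: initial_segment n r).
- by rewrite mem_simplex finset.subsetIr.
- rewrite inE (cplx _ _ AD) ?finset.subsetDl //=.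
  rewrite -finset.setI_eq0; apply/eqP/setP => i.
  by rewrite !inE; case: (i < r)%N; rewrite ?andbF.
by rewrite finset.setID.
Qed.

Lemma free_part_join r Gamma :
  (forall G, G \in Gamma -> [disjoint G & initial_segment n r]) ->
  free_part (simplicial_join (simplex n r) Gamma) r = Gamma.
Proof.
move=> disj; apply/setP => A; rewrite inE; apply/andP/idP => [[/imset2P[F G]] | AG].
  rewrite mem_simplex => Fr GG -> dA.
  suff -> : F = finset.set0 by rewrite finset.set0U.
  apply/eqP; rewrite -finset.subset0; apply/subsetP => i iF.
  have iFG : i \in F :|: G by rewrite inE iF.
  by have := disjointFr dA iFG; rewrite (subsetP Fr i iF).
split; last exact: disj.
apply/imset2P; exists finset.set0 A => //; last by rewrite finset.set0U.
by rewrite mem_simplex finset.sub0set.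
Qed.

Lemma max_card_simplicial_join r Gamma : (r <= n)%N -> Gamma != finset.set0 ->
  (forall G, G \in Gamma -> [disjoint G & initial_segment n r]) ->
  \max_(A in simplicial_join (simplex n r) Gamma) #|A| = (r + \max_(G in Gamma) #|G|)%N.
Proof.
move=> le_rn G0 disj; apply/eqP; rewrite eqn_leq; apply/andP; split.
  apply/bigmax_leqP => A /imset2P[F G]; rewrite mem_simplex => Fr GG -> {A}.
  rewrite (leq_trans (leq_card_setU _ _)) // leq_add //.
    by rewrite -[leqRHS](card_initial_segment le_rn) subset_leq_card.
  exact: (@leq_bigmax_cond _ (fun F => F \in Gamma) (fun F : {set 'I_n} => #|F|)).
have [|G GG ->] := @eq_bigmax_cond _ (fun F => F \in Gamma) (fun F : {set 'I_n} => #|F|).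
  by rewrite card_gt0.
have -> : (r + #|G|)%N = #|initial_segment n r :|: G|.
  by rewrite cardsU disjoint_setI0 ?cards0 ?subn0 ?card_initial_segment // disjoint_sym disj.
apply: (@leq_bigmax_cond _ (fun F => F \in simplicial_join _ _) (fun F : {set 'I_n} => #|F|)).
by apply/imset2P; exists (initial_segment n r) G => //; rewrite mem_simplex.
Qed.

End Joins.

Lemma infinite_field_seq (K : fieldType) : infinite_set [set: K]%classic ->
  forall k, exists2 s : seq K, uniq s & size s = k.
Proof.
move=> infK k; have [B _ le_kB] := infinite_set_fset k infK.
by exists (take k (finmap.enum_fset B)); rewrite ?take_uniq ?finmap.fset_uniq // size_takel.
Qed.

Lemma infinite_field_map (K K' : fieldType) (iota : {rmorphism K -> K'}) :
  (forall k, exists2 s : seq K, uniq s & size s = k) ->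
  forall k, exists2 s : seq K', uniq s & size s = k.
Proof.
move=> infK k; have [s us ss] := infK k.
by exists [seq iota x | x <- s]; rewrite ?size_map // map_inj_uniq //; exact: fmorph_inj.
Qed.

Lemma mem_disjoint_initial n r (A : {set 'I_n}) :
  [disjoint A & initial_segment n r] -> forall x : 'I_n, x \in A -> (r <= x)%N.
Proof.
by move=> dA x xA; have := disjointFr dA xA; rewrite inE => /negbT; rewrite -leqNgt.
Qed.

Lemma disjoint_initialP n r (A : {set 'I_n}) :
  (forall x : 'I_n, x \in A -> (r <= x)%N) -> [disjoint A & initial_segment n r].
Proof.
move=> ge_r; rewrite -finset.setI_eq0; apply/eqP/setP => x; rewrite !inE.
by apply/negP => /andP[/ge_r]; rewrite leqNgt => /negP.
Qed.

(** * Depth and exterior shifting *)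

Section DepthCount.
Variables (K K' : fieldType) (iota : {rmorphism K -> K'}) (n : nat).
Variables (a : 'M[K']_n) (Delta : {set {set 'I_n}}).
Hypothesis infK : forall k, exists2 s : seq K, uniq s & size s = k.
Hypothesis indep : alg_independent iota a.
Hypothesis cplx : simplicial_complex Delta.
Local Notation shift := (ext_shift a Delta).
Local Notation gamma := (free_part shift).

(** For r <= n this says that f_1, ..., f_r is regular, in view of [corank_top_rows]. *)
Definition shift_regular r := (#|gamma r| * 2 ^ r)%N = #|Delta|.

Lemma card_free_part_ge r : (r <= n)%N -> (#|Delta| <= #|gamma r| * 2 ^ r)%N.
Proof.
move=> le_rn; have := corank_ge cplx (row_seq (top_rows le_rn a)).
by rewrite size_row_seq corank_top_rows // (generic_unitmx indep).
Qed.

(** Generic forms have the smallest corank among r forms, and some forms over K attain it. *)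
Lemma regular_forms_exist r : (0 < #|Delta|)%N ->
  (exists2 us : seq 'rV[K]_n, size us = r & regular_forms Delta us) <->
  (r <= n)%N /\ shift_regular r.
Proof.
move=> D0; have corankE le_rn := corank_top_rows cplx (generic_unitmx indep) (r := r) le_rn.
split=> [[us <- rus] | [le_rn rr]].
  (* The power 2^(size us) divides the positive number |Delta|, which is at most 2^n. *)
  have le_n : (size us <= n)%N.
    rewrite -(@leq_exp2l 2) // -[X in (_ <= 2 ^ X)%N]card_ord -cardsT -card_powerset.
    apply: (@leq_trans #|Delta|).
      rewrite -rus leq_pmull // lt0n; apply: contraTneq D0 => c0.
      by rewrite -rus c0.
    by rewrite powersetT cardsT max_card.
  split=> //; apply/eqP; rewrite eqn_leq card_free_part_ge // andbT -rus.
  rewrite leq_mul2r [us in leqRHS]seq_row_seq.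
  have := corank_generic_le Delta indep le_n (\matrix_(i < size us) us`_i).
  by rewrite corank_top_rows // ?(generic_unitmx indep) // => ->; rewrite orbT.
have [g] := corank_generic_attained iota a Delta infK le_rn.
rewrite corankE => le_c; exists (row_seq g); first exact: size_row_seq.
apply/eqP; rewrite eqn_leq corank_ge // andbT size_row_seq -rr.
by rewrite leq_mul2r le_c orbT.
Qed.

(** By the exchange property a regular sequence can be prolonged as soon as some regular sequence is
    longer, so maximality means that none of length r + 1 exists. *)
Lemma has_depth_shift r : has_depth (face_ring K Delta) r <->
  [/\ (0 < #|Delta|)%N, (r <= n)%N, shift_regular r
    & ~ ((r < n)%N /\ shift_regular r.+1)].
Proof.
split=> [[vs [[rvs max_vs] <-]] | [D0 le_rn rr nrr]].
  have [us vsE] := regular_sequenceP rvs; rewrite vsE in rvs max_vs *.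
  have [rus D0] := (regular_sequence_forms cplx us).1 rvs.
  rewrite size_map; have [|le_n rr] := (regular_forms_exist (size us) D0).1.
    by exists us.
  split=> // /(regular_forms_exist (size us).+1 D0)[ws sz rws].
  have [|w rw] := regular_forms_exchange cplx infK (us := [::]) (vs := us) (ws := ws) _ rus rws.
    by rewrite sz.
  case: (max_vs (linear_form w)); rewrite -map_rcons.
  exact/regular_sequence_forms.
have [us sz rus] := (regular_forms_exist r D0).2 (conj le_rn rr).
exists [seq linear_form u | u <- us]; rewrite size_map; split=> //.
split; first exact/regular_sequence_forms.
move=> v rv; have [us' us'E] := regular_sequenceP rv; apply: nrr.
apply/(regular_forms_exist r.+1 D0); exists us'.
  by rewrite -(size_map (@linear_form K n)) -us'E size_rcons size_map sz.
by rewrite us'E in rv; have [] := (regular_sequence_forms cplx us').1 rv.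
Qed.

Lemma shift_regular_join r : (r <= n)%N -> shift_regular r ->
  shift = simplicial_join (simplex n r) (gamma r).
Proof.
move=> le_rn rr; apply/eqP; rewrite eqEcard sub_join_free_part /=; last first.
  exact: ext_shift_complex.
rewrite card_simplicial_join // => [|G]; last by rewrite inE => /andP[].
by rewrite (card_ext_shift cplx (generic_unitmx indep)) -rr mulnC.
Qed.

Lemma nonacyclic_free_part r : (0 < #|Delta|)%N -> (r <= n)%N ->
  shift_regular r -> ~ ((r < n)%N /\ shift_regular r.+1) -> nonacyclic K (gamma r).
Proof.
move=> D0 le_rn rr nrr; have cplx_shift := ext_shift_complex (a := a) cplx.
have set0_gamma : finset.set0 \in gamma r.
  have /card_gt0P[A AS] : (0 < #|shift|)%N.
    by rewrite (card_ext_shift cplx (generic_unitmx indep)).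
  rewrite inE (cplx_shift _ _ AS) ?finset.sub0set //=.
  by apply: disjoint_initialP => x; rewrite inE.
(* For r = n only the empty face is left, and it has nonzero homology in degree -1. *)
have [lt_rn | ge_rn] := ltnP r n; last first.
  suff -> : gamma r = [set finset.set0]%SET by exact: nonacyclic_set0.
  apply/setP => A; rewrite finset.in_set1; apply/idP/eqP => [|-> //].
  rewrite inE => /andP[_ /mem_disjoint_initial ge_r].
  apply/eqP; rewrite -finset.subset0; apply/subsetP => x /ge_r.
  by rewrite leqNgt (leq_trans (ltn_ord x) ge_rn).
(* Vertices are numbered from 0, so v is the vertex r + 1 of [n]. *)
pose v := Ordinal lt_rn.
have [/existsP[A /and3P[AG vA nvA]] | /existsPn no] :=
    boolP [exists A : {set 'I_n}, [&& A \in gamma r, v \notin A & v |: A \notin gamma r]].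
  apply: (@nonacyclic_shifted K n (gamma r) v A AG vA nvA) => F x.
  rewrite !inE => /andP[FS dF] xF vF.
  have vx : (v < x)%N.
    rewrite ltn_neqAle (mem_disjoint_initial dF) // andbT.
    by apply: contraNneq vF => /val_inj ->.
  rewrite (ext_shift_shifted indep (infinite_field_map iota infK)) //=.
  apply: disjoint_initialP => y; rewrite !inE => /orP[/eqP -> //|/andP[_]].
  exact: mem_disjoint_initial.
(* Otherwise adding v maps [gamma r.+1] injectively to the members of [gamma r] containing v. So
   [gamma r] has at least twice as many members, which makes r + 1 regular too. *)
case: nrr; split=> //; apply/eqP; rewrite eqn_leq card_free_part_ge // andbT.
rewrite -rr expnS mulnA leq_mul2r; apply/orP; right.
have vS A : A \in gamma r.+1 -> v \notin A.
  rewrite inE => /andP[_ /mem_disjoint_initial ge_r]; apply/negP => /ge_r.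
  by rewrite ltnn.
have sub_gamma A : A \in gamma r.+1 -> A \in gamma r.
  rewrite !inE => /andP[-> /mem_disjoint_initial ge_r]; apply: disjoint_initialP => x /ge_r.
  exact: ltnW.
have card_cone : #|[set v |: A | A in gamma r.+1]%SET| = #|gamma r.+1|.
  rewrite card_in_imset // => A B /vS vA /vS vB e.
  by rewrite -(setU1K vA) e setU1K.
rewrite muln2 -addnn -{2}card_cone -cardsUI disjoint_setI0 ?cards0 ?addn0.
  apply: subset_leq_card; apply/subsetP => A; rewrite inE => /orP[/sub_gamma //|].
  case/imsetP => B BG ->; have := no B.
  by rewrite (sub_gamma _ BG) (vS _ BG) /= negbK.
rewrite disjoint_subset; apply/subsetP => A /vS vA; rewrite inE.
by apply/imsetP => -[B _ AE]; rewrite AE setU11 in vA.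
Qed.

Lemma shift_join_regular r (Gamma : {set {set 'I_n}}) : (r <= n)%N ->
  (forall G, G \in Gamma -> [disjoint G & initial_segment n r]) ->
  shift = simplicial_join (simplex n r) Gamma ->
  Gamma = gamma r /\ shift_regular r.
Proof.
move=> le_rn disj shiftE.
have GE : Gamma = gamma r by rewrite shiftE free_part_join.
split=> //; rewrite /shift_regular -GE -(card_ext_shift cplx (generic_unitmx indep)).
by rewrite shiftE card_simplicial_join // mulnC.
Qed.

(** The join decomposition for r + 1 shows that [gamma r] is a cone whose apex v is its least
    vertex. *)
Lemma regular_succ_acyclic r : (r < n)%N -> shift_regular r.+1 ->
  ~ nonacyclic K (gamma r).
Proof.
move=> lt_rn rr; pose v := Ordinal lt_rn.
apply: (cone_acyclic (r := v)) => [F|F x]; last first.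
  by rewrite inE => /andP[_ /mem_disjoint_initial]; apply.
rewrite !inE => /andP[FS /mem_disjoint_initial ge_r] vF; apply/andP; split; last first.
  by apply: disjoint_initialP => x; rewrite !inE => /orP[/eqP ->|/ge_r].
rewrite (shift_regular_join lt_rn rr); apply/imset2P; exists [set v]%SET F => //.
  by rewrite mem_simplex finset.sub1set inE /=.
rewrite inE FS /=; apply: disjoint_initialP => x xF; rewrite ltn_neqAle ge_r // andbT.
by apply: contraNneq vF => e; have -> : v = x by apply: val_inj.
Qed.

End DepthCount.

Lemma nonacyclic_neq0 (K : fieldType) n (Gamma : {set {set 'I_n}}) :
  nonacyclic K Gamma -> Gamma != finset.set0.
Proof.
move=> [d [_ [z [zG _ nb]]]]; apply/negP => /eqP G0; apply: nb.
exists 0 => [F|]; first by rewrite ffunE eqxx.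
apply/ffunP => F; rewrite ffunE big1 => [|i _]; last by rewrite ffunE mulr0.
by apply/eqP/negPn/negP => /zG[]; rewrite G0 inE.
Qed.

(** Used to derive r <= n from the dimension formula, before r is known to be bounded by n. *)
Lemma initial_segment_minn n r : initial_segment n r = initial_segment n (minn r n).
Proof.
by apply/setP => i; rewrite !inE leq_min [in RHS](ltn_ord i) andbT.
Qed.

Theorem theorem2p9 (K K' : fieldType) (iota : {rmorphism K -> K'}) (n : nat)
    (a : 'M[K']_n) (Delta : {set {set 'I_n}}) (r : nat) :
  infinite_set [set: K]%classic ->
  alg_independent iota a ->
  simplicial_complex Delta ->
  (forall i : 'I_n, [set i]%SET \in Delta) ->
  (has_depth (face_ring K Delta) r <->
   exists Gamma : {set {set 'I_n}},
    [/\ simplicial_complex Gamma,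
        forall G, G \in Gamma -> [disjoint G & initial_segment n r],
        nonacyclic K Gamma,
        complex_dim Gamma = complex_dim Delta - r%:Z
      & ext_shift a Delta = simplicial_join (simplex n r) Gamma]).
Proof.
move=> /infinite_field_seq infK indep cplx _.
have unit_a := generic_unitmx indep.
have max_shift := ext_shift_max cplx unit_a; have card_shift := card_ext_shift cplx unit_a.
apply: iff_trans (has_depth_shift infK indep cplx r) _; split=> [[D0 le_rn rr nrr] | ].
  have disj G : G \in free_part (ext_shift a Delta) r -> [disjoint G & initial_segment n r].
    by rewrite inE => /andP[].
  have shiftE := shift_regular_join indep cplx le_rn rr.
  have na := nonacyclic_free_part infK indep cplx D0 le_rn rr nrr.
  exists (free_part (ext_shift a Delta) r); split=> //.
    exact: free_part_complex (ext_shift_complex cplx).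
  have := max_card_simplicial_join le_rn (nonacyclic_neq0 na) disj.
  by rewrite -shiftE max_shift /complex_dim => ->; lia.
move=> [Gamma [_ disj na dimE shiftE]]; have G0 := nonacyclic_neq0 na.
(* The simplex on [r] is cut at n, so the join has dimension min(r, n) + dim Gamma; comparing with
   the assumed dimension of Gamma gives min(r, n) = r. *)
have le_rn : (r <= n)%N.
  have := @max_card_simplicial_join n (minn r n) Gamma (geq_minr r n) G0.
  rewrite /simplex -initial_segment_minn => /(_ disj).
  rewrite -/(simplex n r) -shiftE max_shift.
  by move: dimE; rewrite /complex_dim; lia.
have [GE rr] := shift_join_regular indep cplx le_rn disj shiftE.
split=> //.
  rewrite -card_shift shiftE card_simplicial_join // muln_gt0 expn_gt0 /=.
  by rewrite card_gt0.
by case=> lt_rn /(regular_succ_acyclic indep cplx lt_rn (K := K)); rewrite -GE.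
Qed.
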